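(* Let $\bar A\in\mathbb{R}^{m\times n}$ and let $\mathcal{U}$ be a nonempty, compact and convex subset of $\mathbb{R}_+\times\mathbb{R}^m$. Assume that one of the following conditions holds: (i) $\operatorname{rank}(\bar A)=m$, $\mathcal{J}^0(\bar A)=\mathcal{J}(\bar A)$ and $0<\alpha<\kappa(\bar A)$, where $$\kappa(\bar A):=\sup\{\gamma>0\mid \mathcal{J}^0(A)=\mathcal{J}(A)=\mathcal{J}(\bar A)\ \ \forall A\in\mathbb{B}(\bar A,\gamma)\};$$ (ii) $\operatorname{rank}(\bar A)=n$ and $0<\alpha<\sigma_{\min}(\bar A)$. Then $S$ is single-valued and Lipschitz continuous on $\mathcal{U}\times\mathbb{B}(\bar A,\alpha)$.
   Context: Notation: $\mathbb{R}_+=[0,\infty)$; $\|\cdot\|$ is the Euclidean norm of vectors and the spectral norm of matrices, $\|\cdot\|_1$ the $\ell_1$-norm; $\sigma_{\min}(A)$ is the minimum singular value of $A$; $\mathbb{B}(\bar A,\gamma)$ is the closed ball $\{A\in\mathbb{R}^{m\times n}\mid\|A-\bar A\|\le\gamma\}$; $\mathbb{B}$ is the closed unit Euclidean ball; $A_i$ is the $i$th column of $A$ and $A_K$ the submatrix of columns indexed by $K$; $\operatorname{rge}A$ is the range of $A$ and $\operatorname{proj}_{\operatorname{rge}A}b$ the Euclidean projection of $b$ onto it. Solution multifunction $S:\mathbb{R}\times\mathbb{R}^m\times\mathbb{R}^{m\times n}\rightrightarrows\mathbb{R}^n$: if $\lambda>0$, $S(\lambda,b,A)$ is the set of minimizers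 over $x\in\mathbb{R}^n$ of $\frac{1}{2\lambda}\|Ax-\operatorname{proj}_{\operatorname{rge}A}b\|^2+\|x\|_1$ (equivalently of $\frac12\|Ax-b\|^2+\lambda\|x\|_1$); if $\lambda=0$, $S(0,b,A)$ is the set of minimizers of $\|x\|_1$ subject to $Ax=\operatorname{proj}_{\operatorname{rge}A}b$; if $\lambda<0$, $S(\lambda,b,A)=\emptyset$. Index partitions: $I=\{1,\dots,n\}$ and $\mathcal{I}$ is the set of all triples $(I^+,I^0,I^-)$ of pairwise disjoint (possibly empty) subsets of $I$ whose union is $I$. For $A\in\mathbb{R}^{m\times n}$, $\mathcal{J}(A)$ is the set of $(I^+,I^0,I^-)\in\mathcal{I}$ for which there is $y\in\mathbb{R}^m$ with $A_i^\top y=1$ for all $i\in I^+$, $|A_i^\top y|<1$ for all $i\in I^0$, and $A_i^\top y=-1$ for all $i\in I^-$; and $\mathcal{J}^0(A)$ is the set of $(I^+,I^0,I^-)\in\mathcal{J}(A)$ such that either $I^+\cup I^-=\emptyset$ or $\operatorname{rank}A_{I^+\cup I^-}=|I^+\cup I^-|$. A multifunction $G$ is Lipschitz continuous on a set $X$ if $G(x)$ is nonempty and closed for every $x\in X$ and there is $\kappa\ge0$ with $G(x')\subset G(x)+\kappa\|x'-x\|\mathbb{B}$ for all $x,x'\in X$. *)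

(* Defs.v *)
From HB Require Import structures.
From mathcomp Require Import all_boot all_order all_algebra.
From mathcomp Require Import all_classical all_reals all_analysis.

Set Implicit Arguments.
Unset Strict Implicit.
Unset Printing Implicit Defensive.

Import Order.TTheory GRing.Theory Num.Theory.
Import numFieldNormedType.Exports.

Local Open Scope classical_set_scope.
Local Open Scope ring_scope.

(* The library norm on matrices is the entrywise sup norm, so the Euclidean,
   l1 and spectral norms are defined here.  The library topology on matrices is
   the usual one and is used for compactness and closedness. *)

Definition enorm (R : realType) (n : nat) (x : 'cV[R]_n) : R :=
  Num.sqrt (\sum_(i < n) x i 0 ^+ 2).

Definition l1norm (R : realType) (n : nat) (x : 'cV[R]_n) : R :=
  \sum_(i < n) `|x i 0|.

Definition unit_ball (R : realType) (n : nat) : set 'cV[R]_n :=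
  [set x | enorm x <= 1].

Definition specnorm (R : realType) (m n : nat) (A : 'M[R]_(m, n)) : R :=
  sup [set enorm (A *m x) | x in @unit_ball R n].

Definition spec_ball (R : realType) (m n : nat) (A0 : 'M[R]_(m, n)) (r : R) :
    set 'M[R]_(m, n) :=
  [set A | specnorm (A - A0) <= r].

(* Taking the smaller of the two Gram matrices yields exactly the
   min(m, n) singular values, without spurious zeros. *)
Definition singular_value (R : realType) (m n : nat) (A : 'M[R]_(m, n)) :
    set R :=
  [set s | 0 <= s /\
     if (n <= m)%N then eigenvalue (A^T *m A) (s ^+ 2)
     else eigenvalue (A *m A^T) (s ^+ 2)].

Definition sigma_min (R : realType) (m n : nat) (A : 'M[R]_(m, n)) : R :=
  inf (singular_value A).

Definition rge (R : realType) (m n : nat) (A : 'M[R]_(m, n)) : set 'cV[R]_m :=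
  range (fun x : 'cV[R]_n => A *m x).

Definition argmin (R : realType) (T : Type) (D : set T) (f : T -> R) : set T :=
  [set x | D x /\ forall y, D y -> f x <= f y].

(* The nearest point of a linear subspace exists and is unique, so for C a
   subspace the default value 0 is never used. *)
Definition proj (R : realType) (m : nat) (C : set 'cV[R]_m) (b : 'cV[R]_m) :
    'cV[R]_m :=
  xget 0 (argmin C (fun z => enorm (z - b))).

Definition solution (R : realType) (m n : nat)
    (lambda : R) (b : 'cV[R]_m) (A : 'M[R]_(m, n)) : set 'cV[R]_n :=
  let p := proj (rge A) b in
  if 0 < lambda then
    argmin [set: 'cV[R]_n]
      (fun x => 1 / (2 * lambda) * enorm (A *m x - p) ^+ 2 + l1norm x)
  else if lambda == 0 then argmin [set x | A *m x = p] (@l1norm R n)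
  else set0.

(* R^o is R as a vector space over itself.  The product space carries the
   l2 combination of the norms of its factors; any other product norm is
   equivalent and only changes the Lipschitz constant. *)
Definition param_norm (R : realType) (m n : nat)
    (p : (R^o * 'cV[R]_m) * 'M[R]_(m, n)) : R :=
  Num.sqrt (p.1.1 ^+ 2 + enorm p.1.2 ^+ 2 + specnorm p.2 ^+ 2).

Definition solution_map (R : realType) (m n : nat)
    (p : (R^o * 'cV[R]_m) * 'M[R]_(m, n)) : set 'cV[R]_n :=
  solution p.1.1 p.1.2 p.2.

Definition triple (n : nat) : Type :=
  ({set 'I_n} * {set 'I_n} * {set 'I_n})%type.

Definition index_partition (n : nat) : set (triple n) :=
  [set t : triple n | let: (Ip, I0, Im) := t in
     [/\ Ip :&: I0 = finset.set0, Ip :&: Im = finset.set0,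
         I0 :&: Im = finset.set0
       & Ip :|: I0 :|: Im = finset.setT]].

Definition coldot (R : realType) (m n : nat) (A : 'M[R]_(m, n)) (i : 'I_n)
    (y : 'cV[R]_m) : R :=
  ((col i A)^T *m y) 0 0.

Definition J (R : realType) (m n : nat) (A : 'M[R]_(m, n)) : set (triple n) :=
  [set t : triple n | index_partition t /\
     let: (Ip, I0, Im) := t in
     exists y : 'cV[R]_m,
       [/\ forall i, i \in Ip -> coldot A i y = 1,
           forall i, i \in I0 -> `|coldot A i y| < 1
         & forall i, i \in Im -> coldot A i y = -1]].

Definition colset (R : realType) (m n : nat) (A : 'M[R]_(m, n))
    (K : {set 'I_n}) : 'M[R]_(m, #|K|) :=
  colsub (fun k : 'I_#|K| => enum_val k) A.

Definition J0 (R : realType) (m n : nat) (A : 'M[R]_(m, n)) : set (triple n) :=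
  [set t : triple n | J A t /\
     let: (Ip, I0, Im) := t in
     Ip :|: Im = finset.set0 \/
     \rank (colset A (Ip :|: Im)) = #|Ip :|: Im|].

(* Extended-real valued, since the supremum may a priori be infinite. *)
Definition kappa (R : realType) (m n : nat) (A0 : 'M[R]_(m, n)) : \bar R :=
  ereal_sup [set g%:E | g in
    [set g : R | 0 < g /\
       forall A, spec_ball A0 g A -> J0 A = J A /\ J A = J A0]].

Definition single_valued_on (T U : Type) (X : set T) (G : T -> set U) : Prop :=
  forall p, X p -> exists x, G p = [set x].

(* N is the norm of the space of the argument. *)
Definition lipschitz_multifunction (R : realType) (T : zmodType) (N : T -> R)
    (n : nat) (X : set T) (G : T -> set 'cV[R]_n) : Prop :=
  (forall p, X p -> G p !=set0 /\ closed (G p)) /\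
  exists2 k : R, 0 <= k &
    forall p p', X p -> X p' ->
      G p' `<=` [set v + (k * N (p' - p)) *: w | v in G p & w in @unit_ball R n].

(* Main.v *)
Require Import Defs.
From mathcomp Require Import all_boot all_order all_algebra.
From mathcomp Require Import all_classical all_reals all_analysis.
From mathcomp Require Import ring lra.
Import Order.TTheory GRing.Theory Num.Theory.
Import numFieldNormedType.Exports.
Local Open Scope classical_set_scope.
Local Open Scope ring_scope.

(** Let [x] solve the problem at [(lambda, b, A)] with dual certificate [y], that
    is, let [A^T y] be a subgradient of the l1 norm at [x].  The positions where
    [A^T y] equals 1, lies strictly between -1 and 1, or equals -1 form a triple
    [t] of [J A]; the vector [x] vanishes off the active columns of [t], and its
    active part solves the normal equations with right-hand side shifted by
    [lambda] times the signs of [t].  For a fixed [t] these equations ([branch])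
    determine [x] as soon as the active columns are independent, and then [x]
    depends on [(lambda, b, A)] in a Lipschitz way, with a constant controlled by
    a lower bound for [|A v| / |v|] over the active [v] ([branch_lipschitz]).

    There are finitely many triples, so the solution map is a selection from
    finitely many Lipschitz branches.  A branch is the solution wherever it
    satisfies finitely many weak inequalities ([optimal_branch]), which happens on
    a closed set of parameters ([optimal_branch_limit]).  These closed sets cover
    each segment of parameters, and a function that is [L]-Lipschitz on each set
    of a finite closed cover is [L]-Lipschitz on the segment
    ([lipschitz_closed_cover]); this is where convexity enters.  The same
    closedness produces the solution at [lambda = 0]: minimizers exist for
    positive [lambda] by compactness, one triple serves arbitrarily small
    [lambda], and its branch stays optimal in the limit.  For uniqueness at
    [lambda = 0], under (i) the dual certificate is the vector that witnesses
    membership of [t] in [J A], and under (ii) the constraint set is a point.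

    Both hypotheses are used only through [regular].  Under (i) the triples are
    those of [J Abar], common to all matrices of a ball of some radius [g]
    exceeding [alpha].  If [|A v| < (g - alpha) |v|] for some [A] in the smaller
    ball and some active [v], a rank one correction of [A] inside the larger ball
    would annihilate [v] and contradict [J0 = J]; so [g - alpha] is a uniform
    lower bound ([coercive_of_injective_ball]).  Full row rank also persists: the
    dual polytope of [Abar] has a vertex, whose active columns span, and its
    triple keeps independent active columns throughout the ball
    ([vertex_rank_transfer]).  Under (ii) all triples are admitted, with the lower
    bound [sigma_min Abar - alpha]. *)

Set Implicit Arguments.
Unset Strict Implicit.
Unset Printing Implicit Defensive.

(** * Euclidean and spectral norms *)

Section Euclid.
Variable R : realType.

Definition dot n (u v : 'cV[R]_n) : R := (u^T *m v) 0 0.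

Lemma dotE n (u v : 'cV[R]_n) : dot u v = \sum_i u i 0 * v i 0.
Proof. by rewrite /dot mxE; apply: eq_bigr => i _; rewrite mxE. Qed.

Lemma dotC n (u v : 'cV[R]_n) : dot u v = dot v u.
Proof. by rewrite !dotE; apply: eq_bigr => i _; rewrite mulrC. Qed.

Lemma dotDr n (u v w : 'cV[R]_n) : dot u (v + w) = dot u v + dot u w.
Proof. by rewrite /dot mulmxDr mxE. Qed.

Lemma dotDl n (u v w : 'cV[R]_n) : dot (v + w) u = dot v u + dot w u.
Proof. by rewrite !(dotC _ u) dotDr. Qed.

Lemma dotZr n a (u v : 'cV[R]_n) : dot u (a *: v) = a * dot u v.
Proof. by rewrite /dot -scalemxAr mxE. Qed.

Lemma dotZl n a (u v : 'cV[R]_n) : dot (a *: u) v = a * dot u v.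
Proof. by rewrite dotC dotZr dotC. Qed.

Lemma dotNr n (u v : 'cV[R]_n) : dot u (- v) = - dot u v.
Proof. by rewrite -scaleN1r dotZr mulN1r. Qed.

Lemma dotNl n (u v : 'cV[R]_n) : dot (- u) v = - dot u v.
Proof. by rewrite dotC dotNr dotC. Qed.

Lemma dot0r n (u : 'cV[R]_n) : dot u 0 = 0.
Proof. by rewrite -[0](scale0r 0) dotZr mul0r. Qed.

Definition dotL := (dotDl, dotDr, dotNl, dotNr, dotZl, dotZr).

Lemma dot_mulmx m n (A : 'M[R]_(m, n)) u v : dot (A *m u) v = dot u (A^T *m v).
Proof. by rewrite /dot trmx_mul mulmxA. Qed.

Lemma dot_ge0 n (u : 'cV[R]_n) : 0 <= dot u u.
Proof. by rewrite dotE sumr_ge0 // => i _; rewrite -expr2 sqr_ge0. Qed.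

Lemma dot_eq0 n (u : 'cV[R]_n) : (dot u u == 0) = (u == 0).
Proof.
apply/eqP/eqP => [|->]; last by rewrite dot0r.
rewrite dotE => /eqP; rewrite psumr_eq0 => [/allP u0|i _]; last first.
  by rewrite -expr2 sqr_ge0.
apply/matrixP => i j; rewrite ord1 mxE; apply/eqP.
by have := u0 i (mem_index_enum i); rewrite /= mulf_eq0 orbb.
Qed.

Lemma enormE n (x : 'cV[R]_n) : enorm x = Num.sqrt (dot x x).
Proof.
by rewrite /enorm dotE; congr Num.sqrt; apply: eq_bigr => i _; rewrite expr2.
Qed.

Lemma enorm_ge0 n (x : 'cV[R]_n) : 0 <= enorm x.
Proof. exact: sqrtr_ge0. Qed.
#[local] Hint Resolve enorm_ge0 : core.

Lemma sqr_enorm n (x : 'cV[R]_n) : enorm x ^+ 2 = dot x x.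
Proof. by rewrite enormE sqr_sqrtr // dot_ge0. Qed.

Lemma enorm_eq0 n (x : 'cV[R]_n) : (enorm x == 0) = (x == 0).
Proof. by rewrite -dot_eq0 -sqr_enorm sqrf_eq0. Qed.

Lemma enorm0 n : enorm (0 : 'cV[R]_n) = 0.
Proof. by apply/eqP; rewrite enorm_eq0. Qed.

Lemma enorm_gt0 n (x : 'cV[R]_n) : (0 < enorm x) = (x != 0).
Proof. by rewrite lt_neqAle enorm_ge0 andbT eq_sym enorm_eq0. Qed.

Lemma enormZ n a (x : 'cV[R]_n) : enorm (a *: x) = `|a| * enorm x.
Proof.
apply/eqP; rewrite -(@eqrXn2 _ 2) ?mulr_ge0 //.
by rewrite exprMn !sqr_enorm !dotL real_normK ?num_real // mulrA -expr2.
Qed.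

Lemma enormN n (x : 'cV[R]_n) : enorm (- x) = enorm x.
Proof. by rewrite -scaleN1r enormZ normrN1 mul1r. Qed.

Lemma enormB n (x y : 'cV[R]_n) : enorm (x - y) = enorm (y - x).
Proof. by rewrite -enormN opprB. Qed.

(** Cauchy--Schwarz, read off from the nonnegative square of the vector
    [enorm v *: u - enorm u *: v]. *)
Lemma dot_le_enorm n (u v : 'cV[R]_n) : dot u v <= enorm u * enorm v.
Proof.
have [->|u0] := eqVneq u 0; first by rewrite dotC dot0r mulr_ge0.
have [->|v0] := eqVneq v 0; first by rewrite dot0r mulr_ge0.
have := dot_ge0 (enorm v *: u - enorm u *: v).
rewrite !dotL -!sqr_enorm (dotC v u).
have u1 : 0 < enorm u by rewrite enorm_gt0.
have v1 : 0 < enorm v by rewrite enorm_gt0.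
move=> h; have : 0 <= (enorm u * enorm v) * (enorm u * enorm v - dot u v) by nra.
by rewrite pmulr_rge0 ?mulr_gt0 // subr_ge0.
Qed.

Lemma norm_dot_le_enorm n (u v : 'cV[R]_n) : `|dot u v| <= enorm u * enorm v.
Proof.
by rewrite ler_norml dot_le_enorm andbT lerNl -dotNl -(enormN u) dot_le_enorm.
Qed.

Lemma enormD n (u v : 'cV[R]_n) : enorm (u + v) <= enorm u + enorm v.
Proof.
rewrite -ler_sqr ?nnegrE ?addr_ge0 // sqr_enorm !dotL -!sqr_enorm.
by have := dot_le_enorm u v; rewrite (dotC v u); lra.
Qed.

Lemma ler_enormB n (u v : 'cV[R]_n) : enorm (u - v) <= enorm u + enorm v.
Proof. by rewrite -(enormN v) enormD. Qed.

Lemma abs_coord_le_enorm n (x : 'cV[R]_n) i : `|x i 0| <= enorm x.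
Proof.
rewrite -ler_sqr ?nnegrE // sqr_enorm dotE real_normK ?num_real //.
by rewrite (bigD1 i) //= -expr2 lerDl sumr_ge0 // => j _; rewrite -expr2 sqr_ge0.
Qed.

Lemma enorm_le_coord n (x : 'cV[R]_n) r : 0 <= r -> (forall i, `|x i 0| <= r) ->
  enorm x <= n%:R * r.
Proof.
move=> r0 xr; rewrite -ler_sqr ?nnegrE ?mulr_ge0 ?ler0n //.
rewrite sqr_enorm dotE (@le_trans _ _ (\sum_(i < n) r ^+ 2)) //.
  apply: ler_sum => i _; rewrite -expr2 -(real_normK (num_real _)).
  by rewrite ler_sqr ?nnegrE.
rewrite sumr_const card_ord -[r ^+ 2 *+ n]mulr_natl exprMn ler_wpM2r ?sqr_ge0 //.
by rewrite -natrX ler_nat expnS expn1; case: n {x xr} => // n; rewrite leq_pmulr.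
Qed.

Lemma entry_le_norm m n (A : 'M[R]_(m, n)) i j : `|A i j| <= `|A|.
Proof.
rewrite -[leRHS]/(mx_norm A) mx_normrE.
by rewrite (le_bigmax_cond _ (fun ij : _ * _ => `|A ij.1 ij.2|) (j := (i, j))).
Qed.

Lemma enorm_le_mx_norm n (x : 'cV[R]_n) : enorm x <= n%:R * `|x|.
Proof.
by apply: enorm_le_coord => // i; apply: entry_le_norm.
Qed.

Lemma mx_norm_le_enorm n (x : 'cV[R]_n) : `|x| <= enorm x.
Proof.
rewrite -[leLHS]/(mx_norm x) mx_normrE; apply: bigmax_le => // -[i j] _ /=.
by rewrite ord1 abs_coord_le_enorm.
Qed.

Lemma enorm_mulmx_bound m n (A : 'M[R]_(m, n)) :
  exists2 B, 0 <= B & forall x, enorm (A *m x) <= B * enorm x.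
Proof.
pose B := m%:R * \sum_i enorm (row i A)^T; have s0 : 0 <= \sum_i enorm (row i A)^T.
  by apply: sumr_ge0 => i _; apply: enorm_ge0.
exists B => [|x]; first by rewrite mulr_ge0 ?ler0n.
rewrite -mulrA; apply: enorm_le_coord => [|i]; first by rewrite mulr_ge0.
have -> : (A *m x) i 0 = dot (row i A)^T x.
  by rewrite dotE mxE; apply: eq_bigr => j _; rewrite !mxE.
apply: le_trans (norm_dot_le_enorm _ _) _; rewrite ler_wpM2r //.
by rewrite (bigD1 i) //= lerDl sumr_ge0.
Qed.

Lemma specnorm_has_ubound m n (A : 'M[R]_(m, n)) :
  has_ubound [set enorm (A *m x) | x in @unit_ball R n].
Proof.
have [B B0 AB] := enorm_mulmx_bound A.
by exists B => _ [x x1 <-]; apply: le_trans (AB x) _; rewrite ler_piMr.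
Qed.

Lemma unit_ball0 n : @unit_ball R n 0.
Proof. by rewrite /unit_ball /= enorm0 ler01. Qed.

Lemma specnorm_ge0 m n (A : 'M[R]_(m, n)) : 0 <= specnorm A.
Proof.
apply: ub_le_sup; first exact: specnorm_has_ubound.
by exists 0; [exact: unit_ball0 | rewrite mulmx0 enorm0].
Qed.

Lemma enorm_mulmx_le m n (A : 'M[R]_(m, n)) x :
  enorm (A *m x) <= specnorm A * enorm x.
Proof.
have [->|x0] := eqVneq x 0; first by rewrite mulmx0 !enorm0 mulr0.
have x1 : 0 < enorm x by rewrite enorm_gt0.
rewrite -ler_pdivrMr // mulrC -[X in X * _]gtr0_norm ?invr_gt0 // -enormZ scalemxAr.
apply: ub_le_sup; first exact: specnorm_has_ubound.
exists ((enorm x)^-1 *: x) => //; rewrite /unit_ball /= enormZ.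
by rewrite gtr0_norm ?invr_gt0 // mulVf ?gt_eqF.
Qed.

Lemma specnorm_le m n (A : 'M[R]_(m, n)) r : 0 <= r ->
  (forall x, enorm (A *m x) <= r * enorm x) -> specnorm A <= r.
Proof.
move=> r0 Ar; apply: ge_sup.
  by exists (enorm (A *m 0)); exists 0 => //; exact: unit_ball0.
by move=> _ [x x1 <-]; apply: le_trans (Ar x) _; rewrite ler_piMr.
Qed.

Lemma spec_ballP m n (A0 A : 'M[R]_(m, n)) r : 0 <= r ->
  spec_ball A0 r A <-> forall x, enorm ((A - A0) *m x) <= r * enorm x.
Proof.
move=> r0; split=> [Ar x|Ar]; last exact: specnorm_le.
by apply: le_trans (enorm_mulmx_le _ _) _; rewrite ler_wpM2r.
Qed.

(** Bound [|A^T y|^2 = <A A^T y, y>] by Cauchy--Schwarz and cancel [|A^T y|]. *)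
Lemma enorm_trmx_mulmx_le m n (A : 'M[R]_(m, n)) r : 0 <= r ->
  (forall x, enorm (A *m x) <= r * enorm x) ->
  forall y, enorm (A^T *m y) <= r * enorm y.
Proof.
move=> r0 Ar y; have [->|y0] := eqVneq (A^T *m y) 0.
  by rewrite enorm0 mulr_ge0.
have z0 : 0 < enorm (A^T *m y) by rewrite enorm_gt0.
rewrite -(ler_pM2l z0) -expr2 sqr_enorm -dot_mulmx.
apply: le_trans (dot_le_enorm _ _) _.
by rewrite mulrCA mulrA ler_wpM2r.
Qed.

End Euclid.

(** * Minimizers of the penalized objective *)

Section Minimization.
Variable R : realType.

Lemma lipschitz_bound_continuous (V W : normedModType R) (f : V -> W) (L : R) :
  (forall x y, `|f x - f y| <= L * `|x - y|) -> continuous f.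
Proof.
move=> fL x; apply/cvgrPdist_lt => e e0.
have L1 : 0 < `|L| + 1 by rewrite ltr_wpDl.
apply/nbhs_normP; exists (e / (`|L| + 1)) => /=; first by rewrite divr_gt0.
move=> y /=; rewrite ltr_pdivlMr // mulrC => xy.
apply: le_lt_trans (fL x y) (le_lt_trans _ xy).
by rewrite ler_wpM2r // (le_trans (ler_norm L)) // lerDl.
Qed.

Lemma ler_dist_enorm n (x y : 'cV[R]_n) : `|enorm x - enorm y| <= enorm (x - y).
Proof.
rewrite ler_norml; apply/andP; split.
  rewrite lerNl opprB lerBlDr enormB.
  by have := enormD (y - x) x; rewrite subrK.
by rewrite lerBlDr; have := enormD (x - y) y; rewrite subrK.
Qed.

Lemma enorm_affine_continuous m n (A : 'M[R]_(m, n)) p :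
  continuous (fun x : 'cV[R]_n => enorm (A *m x - p)).
Proof.
apply: (@lipschitz_bound_continuous _ _ _ (specnorm A * n%:R)) => x y.
apply: le_trans (ler_dist_enorm _ _) _.
rewrite opprB addrA subrK -mulmxBr; apply: le_trans (enorm_mulmx_le _ _) _.
by rewrite -mulrA ler_wpM2l ?specnorm_ge0 // enorm_le_mx_norm.
Qed.

Lemma l1norm_continuous n : continuous (@l1norm R n).
Proof.
apply: (@lipschitz_bound_continuous _ _ _ n%:R) => x y.
rewrite /l1norm -sumrB; apply: le_trans (ler_norm_sum _ _ _) _.
rewrite (@le_trans _ _ (\sum_(i < n) `|x - y|)) //; last first.
  by rewrite sumr_const card_ord mulr_natl.
apply: ler_sum => i _; apply: le_trans (ler_dist_dist _ _) _.
by apply: le_trans (entry_le_norm _ i 0); rewrite !mxE.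
Qed.

Lemma norm_trmx_le m n (A : 'M[R]_(m, n)) : `|A^T| <= `|A|.
Proof.
rewrite -[leLHS]/(mx_norm _) mx_normrE; apply: bigmax_le => // -[i j] _ /=.
by rewrite mxE entry_le_norm.
Qed.

Lemma trmx_continuous m n : continuous (fun A : 'M[R]_(m, n) => A^T).
Proof.
apply: (@lipschitz_bound_continuous _ _ _ 1) => A B; rewrite mul1r.
by rewrite -linearB /= norm_trmx_le.
Qed.

(** Transposition is continuous, so compactness of closed bounded sets of row
    vectors carries over to column vectors. *)
Lemma argmin_closed_bounded n (C : set 'cV[R]_n) (f : 'cV[R]_n -> R) r :
  C !=set0 -> closed C -> (forall x, C x -> enorm x <= r) -> continuous f ->
  argmin C f !=set0.
Proof.
move=> [x0 Cx0] Ccl Cr fC; pose C' : set 'rV[R]_n := (fun u => u^T) @^-1` C.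
have C'0 : C' !=set0 by exists x0^T; rewrite /C' /= trmxK.
have C'cp : compact C'.
  apply: bounded_closed_compact.
    exists r; split=> [|M /ltW rM u /Cr ur]; first exact: num_real.
    apply: le_trans rM; apply: le_trans ur; rewrite -[u in leLHS]trmxK.
    exact: le_trans (norm_trmx_le _) (mx_norm_le_enorm _).
  by apply: preimage_closed => // x _; apply: trmx_continuous.
have f'C : {within C', continuous (fun u => f u^T)}.
  apply: continuous_subspaceT => u.
  apply: (@continuous_comp _ _ _ (fun u : 'rV[R]_n => u^T) f).
    exact: trmx_continuous.
  exact: fC.
have [c /set_mem cC cmin] := EVT_min_rV C'0 C'cp f'C.
exists c^T; split=> // y Cy.
by have := cmin y^T; rewrite trmxK; apply; apply/mem_set; rewrite /C' /= trmxK.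
Qed.

Definition objective m n (lam : R) (A : 'M[R]_(m, n)) p (x : 'cV[R]_n) : R :=
  1 / (2 * lam) * enorm (A *m x - p) ^+ 2 + l1norm x.

Lemma objective_continuous m n lam (A : 'M[R]_(m, n)) p :
  continuous (objective lam A p).
Proof.
move=> x; have eC := @enorm_affine_continuous _ _ A p x.
exact: cvgD (cvgM (cvg_cst _) (cvgM eC eC)) (@l1norm_continuous n x).
Qed.

Lemma l1norm_ge0 n (x : 'cV[R]_n) : 0 <= l1norm x.
Proof. exact: sumr_ge0. Qed.

Lemma enorm_le_l1norm n (x : 'cV[R]_n) : enorm x <= l1norm x.
Proof.
rewrite -ler_sqr ?nnegrE ?enorm_ge0 ?l1norm_ge0 // sqr_enorm dotE.
rewrite [leRHS]expr2 {1}/l1norm mulr_suml; apply: ler_sum => i _.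
rewrite -expr2 -real_normK ?num_real // expr2 ler_wpM2l // /l1norm (bigD1 i) //=.
by rewrite lerDl sumr_ge0.
Qed.

(** The objective dominates the l1 norm, so its sublevel sets are bounded. *)
Lemma objective_argmin m n lam (A : 'M[R]_(m, n)) p : 0 < lam ->
  argmin [set: 'cV[R]_n] (objective lam A p) !=set0.
Proof.
move=> lam0; pose C := [set x | objective lam A p x <= objective lam A p 0].
have [x [Cx xmin]] : argmin C (objective lam A p) !=set0.
  apply: (@argmin_closed_bounded _ _ _ (objective lam A p 0)).
  - by exists 0; rewrite /C /=.
  - apply: preimage_closed (@closed_le _ _) => x _.
    exact: objective_continuous.
  - move=> x; apply: le_trans; apply: le_trans (enorm_le_l1norm x) _.
    by rewrite lerDr mulr_ge0 ?sqr_ge0 // divr_ge0 // mulr_ge0 // ltW.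
  - exact: objective_continuous.
exists x; split=> // y _.
have [Cy|/ltW xy] := leP (objective lam A p y) (objective lam A p 0).
  exact: xmin.
exact: le_trans Cx xy.
Qed.

(** The negative gradient of half the squared residual; it equals [lam] times a
    subgradient of the l1 norm at a solution. *)
Definition residual_corr m n (A : 'M[R]_(m, n)) b x : 'cV[R]_n := A^T *m (b - A *m x).

(** The gap to [objective x] is a square plus the defect of the subgradient
    inequality at [z], minus the defect at [x]; it serves both the optimality
    conditions and uniqueness. *)
Lemma objective_expand m n lam (A : 'M[R]_(m, n)) p x z : lam != 0 ->
  let g := lam^-1 *: residual_corr A p x in
  objective lam A p z = objective lam A p x
    + 1 / (2 * lam) * enorm (A *m (z - x)) ^+ 2
    + (l1norm z - dot g z) - (l1norm x - dot g x).
Proof.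
move=> lam0 g.
rewrite /objective.
have -> : A *m z - p = A *m (z - x) + (A *m x - p) by rewrite addrA mulmxBr subrK.
rewrite !sqr_enorm.
have -> : dot g z = dot g x + dot g (z - x) by rewrite -dotDr addrC subrK.
have -> : dot g (z - x) = - lam^-1 * dot (A *m (z - x)) (A *m x - p).
  by rewrite /g /residual_corr dotZl dotC -dot_mulmx -[p - _]opprB dotNr mulrN mulNr.
move: (A *m (z - x)) (A *m x - p) => u v.
rewrite !dotL (dotC v u) -mulNr; field.
by rewrite lam0.
Qed.

(** First order optimality for the absolute value: convexity upgrades the
    quadratic perturbation bound to a subgradient inequality. *)
Lemma abs_subgradient (a g x : R) : 0 <= a ->
  (forall t, 0 <= a * t ^+ 2 + (`|x + t| - `|x|) - g * t) ->
  `|g| <= 1 /\ g * x = `|x|.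
Proof.
move=> a0 H.
have sub d : g * d <= `|x + d| - `|x|.
  rewrite leNgt; apply/negP => lt; set D := `|x + d| - `|x| in lt.
  have e0 : 0 < g * d - D by rewrite subr_gt0.
  (* a step so short that the quadratic term eats at most half of the deficit *)
  pose th := Num.min 1 ((g * d - D) / (2 * (a * d ^+ 2 + 1))).
  have q0 : 0 < a * d ^+ 2 + 1 by rewrite ltr_wpDl // mulr_ge0 // sqr_ge0.
  have th0 : 0 < th by rewrite lt_min ltr01 divr_gt0 // mulr_gt0.
  have th1 : th <= 1 by rewrite ge_min lexx.
  have th2 : th * (2 * (a * d ^+ 2 + 1)) <= g * d - D.
    by rewrite -ler_pdivlMr ?mulr_gt0 // ge_min lexx orbT.
  have cv : `|x + th * d| - `|x| <= th * D.
    have -> : x + th * d = (1 - th) * x + th * (x + d) by ring.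
    apply: le_trans (lerB (ler_normD _ _) (lexx _)) _.
    rewrite !normrM (ger0_norm (ltW th0)) ger0_norm ?subr_ge0 // /D.
    by rewrite le_eqVlt; apply/predU1P; left; ring.
  have := H (th * d); nra.
have gx : g * x = `|x|.
  apply/eqP; rewrite eq_le; apply/andP; split.
    have := sub x; rewrite -mulr2n normrMn mulr2n; lra.
  have := sub (- x); rewrite subrr normr0; lra.
split=> //; rewrite ler_norml; apply/andP; split.
  have := sub (- x - 1); rewrite addrA subrr sub0r normrN1 mulrBr mulrN gx; lra.
by have := sub (1 - x); rewrite addrCA subrr addr0 normr1 mulrBr gx; lra.
Qed.

Lemma objective_argmin_kkt m n lam (A : 'M[R]_(m, n)) p x : 0 < lam ->
  argmin setT (objective lam A p) x ->
  let g := lam^-1 *: residual_corr A p x in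
  forall i, `|g i 0| <= 1 /\ g i 0 * x i 0 = `|x i 0|.
Proof.
move=> lam0 [_ xmin] g i.
pose e : 'cV[R]_n := delta_mx i 0.
apply: (@abs_subgradient (1 / (2 * lam) * enorm (A *m e) ^+ 2)).
  by rewrite mulr_ge0 ?sqr_ge0 // divr_ge0 // mulr_ge0 // ltW.
move=> t; have := xmin (x + t *: e) I.
rewrite (objective_expand A p x (x + t *: e)) ?gt_eqF // -/g.
rewrite [x + _ - x]addrC addKr -scalemxAr enormZ exprMn real_normK ?num_real //.
have -> : l1norm (x + t *: e) = l1norm x + (`|x i 0 + t| - `|x i 0|).
  rewrite /l1norm [in LHS](bigD1 i) //= [in RHS](bigD1 i) //= !mxE !eqxx mulr1.
  rewrite (eq_bigr (fun j => `|x j 0|)) => [|j /negPf ji]; first by ring.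
  by rewrite !mxE ji /= mulr0 addr0.
have -> : dot g (x + t *: e) = dot g x + g i 0 * t.
  rewrite dotDr dotZr [dot g e]dotE (bigD1 i) //= big1 => [|j /negPf ji].
    by rewrite [e _ _]mxE !eqxx addr0 mulr1 mulrC.
  by rewrite [e _ _]mxE ji mulr0.
move=> h; rewrite -subr_ge0 in h; apply: le_trans h _.
by rewrite le_eqVlt; apply/predU1P; left; ring.
Qed.

Lemma dot_le_l1norm n (g z : 'cV[R]_n) : (forall i, `|g i 0| <= 1) ->
  dot g z <= l1norm z.
Proof.
move=> g1; rewrite dotE; apply: ler_sum => i _; apply: le_trans (ler_norm _) _.
by rewrite normrM ler_piMl.
Qed.

(** The gap [l1norm z - dot g z] is a sum of nonnegative terms, and the term of
    an index where [g] does not saturate vanishes only with [z i]. *)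
Lemma dot_eq_l1norm_supp n (g z : 'cV[R]_n) : (forall i, `|g i 0| <= 1) ->
  l1norm z <= dot g z -> forall i, `|g i 0| < 1 -> z i 0 = 0.
Proof.
move=> g1 zg i gi.
have t0 j : true -> 0 <= `|z j 0| - g j 0 * z j 0.
  move=> _; rewrite subr_ge0; apply: le_trans (ler_norm _) _.
  by rewrite normrM ler_piMl.
have : \sum_j (`|z j 0| - g j 0 * z j 0) == 0.
  by rewrite eq_le sumr_ge0 // andbT sumrB -dotE subr_le0.
rewrite psumr_eq0 // => /allP /(_ i (mem_index_enum i)) /eqP zi.
apply/eqP; rewrite -normr_eq0; apply/negPn/negP => z0.
have {}z0 : 0 < `|z i 0| by rewrite lt_def z0 normr_ge0.
have := ler_norm (g i 0 * z i 0); rewrite normrM.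
have : `|g i 0| * `|z i 0| < `|z i 0| by rewrite -[ltRHS]mul1r ltr_pM2r.
lra.
Qed.

End Minimization.

(** * Sign patterns and branches of the solution map *)

Section Branches.
Variable R : realType.

Definition active n (t : triple n) : {set 'I_n} := t.1.1 :|: t.2.

Definition signs n (t : triple n) : 'cV[R]_n :=
  \col_i ((i \in t.1.1)%:R - (i \in t.2)%:R).

Definition supported n (K : {set 'I_n}) (v : 'cV[R]_n) : Prop :=
  forall i, i \notin K -> v i 0 = 0.

Lemma normr_signs_active n (t : triple n) i :
  index_partition t -> i \in active t -> `|signs t i 0| = 1.
Proof.
case: t => [[Ip I0] Im] [_ /setP /(_ i) + _ _]; rewrite /active /= !inE mxE /=.
case: (i \in Ip); case: (i \in Im) => //= _ _; first by rewrite subr0 normr1.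
by rewrite sub0r normrN1.
Qed.

Lemma normr_signs_le1 n (t : triple n) i : `|signs t i 0| <= 1.
Proof.
rewrite mxE; case: (i \in _); case: (i \in _);
  by rewrite ?subrr ?subr0 ?sub0r ?normrN ?normr1 ?normr0 ?lexx ?ler01.
Qed.

Lemma inactiveE n (t : triple n) i :
  index_partition t -> (i \notin active t) = (i \in t.1.2).
Proof.
case: t => [[Ip I0] Im] [/setP/(_ i) + _ /setP/(_ i) + /setP/(_ i)].
by rewrite /active /= !inE; case: (i \in Ip); case: (i \in Im); case: (i \in I0).
Qed.

(** The triple read off a dual feasible vector [g = A^T y]. *)
Definition sign_triple n (g : 'cV[R]_n) : triple n :=
  ([set i | g i 0 == 1], [set i | `|g i 0| < 1], [set i | g i 0 == -1])%SET.

Lemma sign_triple_partition n (g : 'cV[R]_n) :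
  (forall i, `|g i 0| <= 1) -> index_partition (sign_triple g).
Proof.
move=> g1; split; apply/setP => i; rewrite !inE.
- by case: eqP => //= ->; rewrite normr1 ltxx.
- by case: eqP => //= ->; apply/negbTE; rewrite -subr_eq0 opprK paddr_eq0 // oner_eq0.
- by rewrite andbC; case: eqP => //= ->; rewrite normrN1 ltxx.
have := g1 i; rewrite le_eqVlt => /orP[|->]; last by rewrite orbT.
by rewrite eqr_norml ler01 andbT => /orP[] ->; rewrite ?orbT.
Qed.

Lemma inactive_sign_triple n (g : 'cV[R]_n) i : (forall i, `|g i 0| <= 1) ->
  i \notin active (sign_triple g) -> `|g i 0| < 1.
Proof. by move=> /sign_triple_partition/inactiveE ->; rewrite inE. Qed.

Lemma signs_sign_triple n (g : 'cV[R]_n) i : i \in active (sign_triple g) ->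
  signs (sign_triple g) i 0 = g i 0.
Proof.
rewrite /active !inE mxE !inE => /orP[]/eqP->; rewrite eqxx.
  by rewrite -subr_eq0 opprK paddr_eq0 // oner_eq0 subr0.
by rewrite eq_sym -subr_eq0 opprK paddr_eq0 // oner_eq0 sub0r.
Qed.

Lemma coldotE m n (A : 'M[R]_(m, n)) i y : coldot A i y = (A^T *m y) i 0.
Proof. by rewrite /coldot tr_col -row_mul mxE. Qed.

Lemma sign_triple_J m n (A : 'M[R]_(m, n)) y :
  (forall i, `|(A^T *m y) i 0| <= 1) -> J A (sign_triple (A^T *m y)).
Proof.
move=> g1; split; first exact: sign_triple_partition.
by exists y; split=> i; rewrite inE coldotE => // /eqP.
Qed.

(** The equations satisfied by a solution whose dual certificate saturates
    exactly the constraints of [t]: they determine it once the active columns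
    are independent. *)
Definition branch m n (t : triple n) lam b (A : 'M[R]_(m, n)) (x : 'cV[R]_n) :=
  forall i, if i \in active t
    then residual_corr A b x i 0 = lam * signs t i 0 else x i 0 = 0.

(** Optimality of a branch: every inequality is weak, so that the condition passes
    to limits, at the price of not fixing the triple of the residual itself.  At
    [lam = 0] it forces the residual correlation to vanish. *)
Definition optimal_branch m n (t : triple n) lam b (A : 'M[R]_(m, n)) x :=
  branch t lam b A x /\
  forall i, 0 <= signs t i 0 * x i 0 /\ `|residual_corr A b x i 0| <= lam.

Lemma branch_supported m n t lam b (A : 'M[R]_(m, n)) x :
  branch t lam b A x -> supported (active t) x.
Proof. by move=> + i /negPf it => /(_ i); rewrite it. Qed.

(** The normal equations characterize the projection, by Pythagoras. *)
Lemma proj_normal m n (A : 'M[R]_(m, n)) b (z : 'cV[R]_n) : A^T *m (b - A *m z) = 0 ->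
  Defs.proj (rge A) b = A *m z.
Proof.
move=> Az.
have pyth u : enorm (A *m u - b) ^+ 2 =
    enorm (A *m u - A *m z) ^+ 2 + enorm (A *m z - b) ^+ 2.
  have -> : A *m u - b = A *m (u - z) - (b - A *m z).
    by rewrite mulmxBr opprB addrA subrK.
  rewrite -(enormB b) -mulmxBr !sqr_enorm.
  have : dot (A *m (u - z)) (b - A *m z) = 0 by rewrite dot_mulmx Az dot0r.
  move: (A *m (u - z)) (b - A *m z) => p q; rewrite !dotL (dotC q p) => ->; ring.
apply: xget_unique.
  split; first by exists z.
  move=> _ [u _ <-]; rewrite -ler_sqr ?nnegrE ?enorm_ge0 // [leRHS]pyth.
  by rewrite lerDr sqr_ge0.
move=> _ [[u _ <-]] /(_ (A *m z)) /(_ (ex_intro2 _ _ z I erefl)).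
rewrite -ler_sqr ?nnegrE ?enorm_ge0 // [leLHS]pyth gerDr => h.
apply/eqP; rewrite -subr_eq0 -enorm_eq0 -sqrf_eq0 eq_le h /=.
exact: sqr_ge0.
Qed.

Definition active_injective m n (A : 'M[R]_(m, n)) (t : triple n) :=
  forall v, supported (active t) v -> A *m v = 0 -> v = 0.

(** Replacing [b] by its projection changes the residual by a vector orthogonal to
    the columns of [A]. *)
Lemma residual_corr_proj m n (A : 'M[R]_(m, n)) b (z x : 'cV[R]_n) :
  A^T *m (b - A *m z) = 0 ->
  residual_corr A (A *m z) x = residual_corr A b x.
Proof.
move=> Az; rewrite /residual_corr.
have -> : b - A *m x = (b - A *m z) + (A *m z - A *m x) by rewrite addrA subrK.
by rewrite [RHS]mulmxDr Az add0r.
Qed.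

Lemma l1norm_signs n (t : triple n) (x : 'cV[R]_n) i : index_partition t ->
  i \in active t -> 0 <= signs t i 0 * x i 0 -> signs t i 0 * x i 0 = `|x i 0|.
Proof.
move=> tP it sx; rewrite -(ger0_norm sx) normrM.
by rewrite normr_signs_active // mul1r.
Qed.

(** The residual divided by [lam] is the dual certificate.  Any other minimizer
    has the same image under [A] and is supported where the certificate
    saturates, so the difference is an active vector for the triple of the
    certificate; that triple may be larger than [t]. *)
Lemma optimal_branch_solution_pos m n (A : 'M[R]_(m, n)) t lam b (z x : 'cV[R]_n) :
    0 < lam -> index_partition t -> A^T *m (b - A *m z) = 0 ->
    (forall t', J A t' -> active_injective A t') ->
  optimal_branch t lam b A x -> solution lam b A = [set x].
Proof.
move=> lam0 tP Az Ainj [xB xO]; rewrite /solution lam0 (proj_normal Az).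
pose y := lam^-1 *: (A *m z - A *m x).
pose g := lam^-1 *: residual_corr A (A *m z) x.
have gE : g = A^T *m y by rewrite /g /y /residual_corr -scalemxAr.
have gi i : g i 0 = lam^-1 * residual_corr A b x i 0.
  by rewrite -(residual_corr_proj x Az) mxE.
have g1 i : `|g i 0| <= 1.
  rewrite gi normrM gtr0_norm ?invr_gt0 // mulrC ler_pdivrMr // mul1r.
  by have [] := xO i.
have lx : l1norm x = dot g x.
  rewrite dotE; apply: eq_bigr => i _; have := xB i; have [sx _] := xO i.
  case: ifPn => it; last by move=> ->; rewrite normr0 mulr0.
  by rewrite gi => ->; rewrite mulKf ?gt_eqF // l1norm_signs.
have FE u : objective lam A (A *m z) u = objective lam A (A *m z) x
    + 1 / (2 * lam) * enorm (A *m (u - x)) ^+ 2 + (l1norm u - dot g u).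
  rewrite (objective_expand A _ x u) ?gt_eqF // -/g lx.
  by rewrite [dot g x - _]subrr subr0.
have c0 : 0 < 1 / (2 * lam) by rewrite divr_gt0 // mulr_gt0.
have q0 u : 0 <= 1 / (2 * lam) * enorm (A *m (u - x)) ^+ 2.
  by rewrite mulr_ge0 ?sqr_ge0 // ltW.
apply/seteqP; split=> [u [_ /(_ x I)]|_ ->]; last first.
  split=> // u _; rewrite -/(objective _ _ _ _) -/(objective _ _ _ _) (FE u).
  by rewrite -addrA lerDl addr_ge0 // subr_ge0 dot_le_l1norm.
rewrite -/(objective _ _ _ _) -/(objective _ _ _ _) (FE u) -addrA gerDl => le0.
have lu := dot_le_l1norm u g1.
have Q0 : 1 / (2 * lam) * enorm (A *m (u - x)) ^+ 2 = 0 by have := q0 u; lra.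
have {}lu : l1norm u <= dot g u by have := q0 u; lra.
have tJ : J A (sign_triple g) by rewrite gE; apply: sign_triple_J; rewrite -gE.
apply/eqP; rewrite -subr_eq0; apply/eqP; apply: Ainj tJ _ _ _.
  move=> i /(inactive_sign_triple g1) gi1; rewrite !mxE.
  rewrite (dot_eq_l1norm_supp g1 lu gi1) (dot_eq_l1norm_supp g1 _ gi1) ?lx //.
  by rewrite subr0.
move/eqP: Q0; rewrite mulf_eq0 gt_eqF //= sqrf_eq0 enorm_eq0.
by move/eqP.
Qed.

(** The triple is read off the certificate of a minimizer. *)
Lemma optimal_branch_exists_pos m n (A : 'M[R]_(m, n)) lam b (z : 'cV[R]_n) :
    0 < lam -> A^T *m (b - A *m z) = 0 ->
  exists t x, J A t /\ optimal_branch t lam b A x.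
Proof.
move=> lam0 Az; have [x xmin] := objective_argmin A (A *m z) lam0.
have := objective_argmin_kkt lam0 xmin; set g := _ *: _ => kkt.
have gE : g = A^T *m (lam^-1 *: (A *m z - A *m x)).
  by rewrite /g /residual_corr -scalemxAr.
have g1 i : `|g i 0| <= 1 by have [] := kkt i.
have rE i : residual_corr A b x i 0 = lam * g i 0.
  by rewrite -(residual_corr_proj x Az) [g _ _]mxE mulVKf ?gt_eqF.
exists (sign_triple g), x; split.
  by rewrite gE; apply: sign_triple_J; rewrite -gE.
have xB : branch (sign_triple g) lam b A x.
  move=> i; case: ifPn => it; first by rewrite rE signs_sign_triple.
  have gi := inactive_sign_triple g1 it; have [_ gx] := kkt i.
  apply/eqP; rewrite -normr_eq0; apply/negPn/negP => z0.
  have {}z0 : 0 < `|x i 0| by rewrite lt_def z0 normr_ge0.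
  have := ler_norm (g i 0 * x i 0); rewrite normrM gx.
  by rewrite leNgt -[ltRHS]mul1r ltr_pM2r ?gi.
split=> // i; split; last first.
  by rewrite rE normrM gtr0_norm // ler_piMr // ltW.
have := xB i; case: ifPn => [it _|_ ->]; last by rewrite mulr0.
by rewrite signs_sign_triple //; have [_ ->] := kkt i.
Qed.

Lemma solution0 m n (A : 'M[R]_(m, n)) b :
  solution 0 b A = argmin [set x | A *m x = Defs.proj (rge A) b] (@l1norm R n).
Proof. by rewrite /solution ltxx eqxx. Qed.

Lemma optimal_branch0 m n (A : 'M[R]_(m, n)) t b x : optimal_branch t 0 b A x ->
  A^T *m (b - A *m x) = 0.
Proof.
move=> [_ xO]; apply/matrixP => i j; rewrite ord1 [in RHS]mxE.
by apply/eqP; rewrite -normr_eq0 eq_le normr_ge0 andbT; have [] := xO i.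
Qed.

Lemma optimal_branch_solution0_injective m n (A : 'M[R]_(m, n)) t b x :
    (forall v : 'cV[R]_n, A *m v = 0 -> v = 0) ->
  optimal_branch t 0 b A x -> solution 0 b A = [set x].
Proof.
move=> Ainj /optimal_branch0 Ax; rewrite solution0 (proj_normal Ax).
have uniq u : A *m u = A *m x -> u = x.
  move=> ux; apply/eqP; rewrite -subr_eq0; apply/eqP/Ainj.
  by rewrite mulmxBr ux subrr.
apply/seteqP; split=> [u [/= /uniq]|_ ->] //.
by split=> // u /uniq ->.
Qed.

(** Here the residual vanishes and carries no dual information; the certificate
    comes from [J A t], and its strict inequalities off the active set confine
    every minimizer to the active columns. *)
Lemma optimal_branch_solution0_surjective m n (A : 'M[R]_(m, n)) t b x :
    (forall y : 'cV[R]_m, A^T *m y = 0 -> y = 0) ->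
    J A t -> active_injective A t ->
  optimal_branch t 0 b A x -> solution 0 b A = [set x].
Proof.
case: t => [[Ip I0] Im]; set t : triple n := (Ip, I0, Im).
move=> Asurj tJ tinj xB; have Ax := optimal_branch0 xB.
rewrite solution0 (proj_normal Ax).
have [tP [y [yp y0 ym]]] := tJ; set g := A^T *m y.
have gi i : if i \in active t then g i 0 = signs t i 0 else `|g i 0| < 1.
  rewrite /g -coldotE; case: ifPn => [|]; last by rewrite inactiveE // => /y0.
  have /= := tP; case=> _ /setP/(_ i) + _ _.
  rewrite /active /t /= !inE mxE /=; have [/yp ->|_] := boolP (i \in Ip).
    by case: (i \in Im) => // _ _; rewrite subr0.
  by have [/ym ->|] := boolP (i \in Im); rewrite // sub0r.
have g1 i : `|g i 0| <= 1.
  by have := gi i; case: ifP => _ => [->|/ltW //]; exact: normr_signs_le1.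
have lx : l1norm x = dot g x.
  rewrite dotE; apply: eq_bigr => i _; case: xB => /(_ i) + /(_ i) [sx _].
  have := gi i; case: ifPn => [it -> _|_ _ ->]; last first.
    by rewrite normr0 mulr0.
  by rewrite l1norm_signs.
have dotg u : A *m u = A *m x -> dot g u = dot g x.
  by move=> ux; rewrite /g !(dotC (A^T *m y)) -!dot_mulmx ux.
apply/seteqP; split=> [u [/= ux /(_ x erefl) lu]|_ ->]; last first.
  by split=> // u /dotg ux; rewrite lx -ux dot_le_l1norm.
apply/eqP; rewrite -subr_eq0; apply/eqP; apply: tinj; last first.
  by rewrite mulmxBr ux subrr.
move=> i it; rewrite !mxE.
have := gi i; rewrite (negPf it) => gi1.
rewrite !(dot_eq_l1norm_supp g1 _ gi1) ?subrr ?lx //.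
by rewrite (dotg _ ux) -lx.
Qed.

End Branches.

(** * Stability of a branch *)

Section Stability.
Variable R : realType.

Lemma injective_solvable n (M : 'M[R]_n) :
  (forall v : 'cV[R]_n, M *m v = 0 -> v = 0) ->
  forall b, exists x : 'cV[R]_n, M *m x = b.
Proof.
move=> Minj b; have Mu : M \in unitmx.
  rewrite -unitmx_tr -row_free_unit; apply: inj_row_free => v vM.
  by rewrite -[v]trmxK (Minj v^T) ?trmx0 // -[M]trmxK -trmx_mul vM trmx0.
by exists (invmx M *m b); rewrite mulKVmx.
Qed.

Lemma gram_mulmx_eq0 m n (A : 'M[R]_(m, n)) (v : 'cV[R]_n) :
  A^T *m (A *m v) = 0 -> A *m v = 0.
Proof. by move=> Av; apply/eqP; rewrite -dot_eq0 dot_mulmx Av dot0r. Qed.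

Lemma normal_equation_solvable_injective m n (A : 'M[R]_(m, n)) b :
  (forall v : 'cV[R]_n, A *m v = 0 -> v = 0) ->
  exists z : 'cV[R]_n, A^T *m (b - A *m z) = 0.
Proof.
move=> Ainj; have Ginj (v : 'cV[R]_n) : A^T *m A *m v = 0 -> v = 0.
  by rewrite -mulmxA => /gram_mulmx_eq0/Ainj.
have [z Az] := injective_solvable Ginj (A^T *m b).
by exists z; rewrite mulmxBr mulmxA Az subrr.
Qed.

Lemma normal_equation_solvable_surjective m n (A : 'M[R]_(m, n)) b :
  (forall y : 'cV[R]_m, A^T *m y = 0 -> y = 0) ->
  exists z : 'cV[R]_n, A^T *m (b - A *m z) = 0.
Proof.
move=> Asurj; have Ginj (v : 'cV[R]_m) : A *m A^T *m v = 0 -> v = 0.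
  by rewrite -mulmxA -{1}[A]trmxK => /gram_mulmx_eq0; exact: Asurj.
have [y Ay] := injective_solvable Ginj b.
by exists (A^T *m y); rewrite mulmxA Ay subrr mulmx0.
Qed.

Definition coercive_on n m (A : 'M[R]_(m, n)) c (t : triple n) :=
  forall v, supported (active t) v -> c * enorm v <= enorm (A *m v).

Lemma coercive_injective n m (A : 'M[R]_(m, n)) c t : 0 < c ->
  coercive_on A c t -> active_injective A t.
Proof.
move=> c0 Ac v vt Av; have := Ac v vt.
rewrite Av enorm0 pmulr_rle0 // => v0.
by apply/eqP; rewrite -enorm_eq0 eq_le v0 enorm_ge0.
Qed.

(** The square system made of the normal equations in the active rows and of
    [x i = 0] in the other rows is injective, hence solvable. *)
Lemma branch_exists m n t lam b (A : 'M[R]_(m, n)) :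
  active_injective A t -> exists x, branch t lam b A x.
Proof.
move=> Ainj.
pose M := \matrix_(i, j) if i \in active t then (A^T *m A) i j else (i == j)%:R.
have ME (v : 'cV[R]_n) i : (M *m v) i 0 =
    if i \in active t then (A^T *m (A *m v)) i 0 else v i 0.
  rewrite mulmxA mxE; case: ifPn => it.
    by rewrite [in RHS]mxE; apply: eq_bigr => j _; rewrite mxE it.
  rewrite (bigD1 i) //= big1 => [|j ji]; rewrite mxE (negPf it) ?eqxx ?mul1r ?addr0 //.
  by rewrite eq_sym (negPf ji) mul0r.
have Minj (v : 'cV[R]_n) : M *m v = 0 -> v = 0.
  move=> Mv; have vt : supported (active t) v.
    by move=> i it; have := ME v i; rewrite Mv mxE (negPf it).
  apply: Ainj => //; apply/eqP; rewrite -dot_eq0 dot_mulmx dotE big1 // => i _.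
  have := ME v i; rewrite Mv [LHS]mxE; case: ifPn => [_ <-|it _]; first by rewrite mulr0.
  by rewrite (vt i it) mul0r.
have [x Mx] := injective_solvable Minj
    (\col_i if i \in active t then (A^T *m b) i 0 - lam * signs R t i 0 else 0).
exists x => i; have := ME x i; rewrite Mx [LHS]mxE; case: ifPn => // it xi.
rewrite /residual_corr mulmxBr [LHS]mxE [X in _ + X]mxE -xi; ring.
Qed.

Definition bounded_by m n (M lam : R) (b : 'cV[R]_m) (A : 'M[R]_(m, n)) :=
  [/\ `|lam| <= M, enorm b <= M & forall v, enorm (A *m v) <= M * enorm v].

Definition params_close m n (N lam : R) (b : 'cV[R]_m) (A : 'M[R]_(m, n)) lam' b' A' :=
  bounded_by N (lam - lam') (b - b') (A - A').

Lemma dot_residual_branch m n t lam b (A : 'M[R]_(m, n)) x w :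
  branch t lam b A x -> supported (active t) w ->
  dot (A *m w) (b - A *m x) = lam * dot w (signs R t).
Proof.
move=> xB wt; rewrite dot_mulmx !dotE mulr_sumr; apply: eq_bigr => i _.
have := xB i; case: ifPn => [_|it _]; last by rewrite (wt i it) !mul0r mulr0.
by rewrite /residual_corr => ->; rewrite mulrCA.
Qed.

(** Test the branch equations against the branch itself. *)
Lemma branch_bound m n t lam b (A : 'M[R]_(m, n)) c M x :
    0 < c -> 0 <= M -> coercive_on A c t -> bounded_by M lam b A ->
    branch t lam b A x ->
  enorm x <= M * (M + n%:R) / c ^+ 2.
Proof.
move=> c0 M0 Ac [lamM bM AM] xB.
have xt := branch_supported xB.
have xe := enorm_ge0 x; have Ax := Ac x xt.
have [->|x0] := eqVneq x 0.
  by rewrite enorm0 divr_ge0 ?sqr_ge0 // mulr_ge0 // addr_ge0.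
have {}x0 : 0 < enorm x by rewrite enorm_gt0.
rewrite ler_pdivlMr ?exprn_gt0 // -(ler_pM2l x0).
have sN : enorm (signs R t) <= n%:R.
  by rewrite -[leRHS]mulr1; apply: enorm_le_coord => // i; apply: normr_signs_le1.
have := dot_residual_branch xB xt; rewrite dotDr dotNr -sqr_enorm => /eqP.
rewrite subr_eq => /eqP E.
have h1 := dot_le_enorm (A *m x) b.
have h2 := norm_dot_le_enorm x (signs R t).
have h3 : enorm (A *m x) * enorm b <= (M * enorm x) * M.
  by apply: ler_pM; rewrite ?enorm_ge0.
have h4 : `|lam * dot x (signs R t)| <= M * (enorm x * n%:R).
  rewrite normrM; apply: ler_pM => //; apply: le_trans h2 _.
  by rewrite ler_wpM2l.
have h5 := ler_norm (- (lam * dot x (signs R t))); rewrite normrN in h5.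
have h6 : (c * enorm x) ^+ 2 <= enorm (A *m x) ^+ 2.
  by rewrite ler_sqr ?nnegrE ?enorm_ge0 // mulr_ge0 // ltW.
rewrite exprMn in h6.
have -> : enorm x * (enorm x * c ^+ 2) = c ^+ 2 * enorm x ^+ 2 by ring.
have -> : enorm x * (M * (M + n%:R)) = (M * enorm x) * M + M * (enorm x * n%:R) by ring.
lra.
Qed.

(** Test both branch equations against the difference [w] of the two points,
    which is active: the terms in the sign vector differ only by the factor
    [lam - lam'], and what remains is [|A w|^2] against perturbation terms. *)
Lemma branch_lipschitz m n t c M lam b (A : 'M[R]_(m, n)) x lam' b' A' x' N X :
    0 < c -> 0 <= M -> 0 <= N -> coercive_on A c t ->
    bounded_by M lam b A -> bounded_by M lam' b' A' ->
    branch t lam b A x -> branch t lam' b' A' x' ->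
    enorm x' <= X -> params_close N lam b A lam' b' A' ->
  enorm (x - x') <= (2 * M + 2 * M * X + n%:R) / c ^+ 2 * N.
Proof.
move=> c0 M0 N0 Ac [_ bM AM] [_ _ A'M] xB x'B x'X [lamN bN AN].
have wt : supported (active t) (x - x').
  by move=> i it; rewrite !mxE (branch_supported xB it) (branch_supported x'B it) subr0.
have X0 : 0 <= X by apply: le_trans x'X; apply: enorm_ge0.
have := Ac _ wt; set w := x - x' => Aw.
have [->|w0] := eqVneq w 0.
  rewrite enorm0 mulr_ge0 // divr_ge0 ?sqr_ge0 //.
  by rewrite !addr_ge0 ?mulr_ge0.
have {}w0 : 0 < enorm w by rewrite enorm_gt0.
rewrite mulrAC ler_pdivlMr ?exprn_gt0 // -(ler_pM2l w0).
have E1 := dot_residual_branch xB wt; have E2 := dot_residual_branch x'B wt.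
have sN : enorm (signs R t) <= n%:R.
  by rewrite -[leRHS]mulr1; apply: enorm_le_coord => // i; apply: normr_signs_le1.
have E : enorm (A *m w) ^+ 2 = dot ((A - A') *m w) (b - A *m x')
    + dot (A' *m w) ((b - b') - (A - A') *m x') - (lam - lam') * dot w (signs R t).
  rewrite mulrBl -E1 -E2 sqr_enorm.
  have -> : A *m x = A *m w + A *m x' by rewrite -mulmxDr subrK.
  rewrite !mulmxBl; move: (A *m w) (A' *m w) (A *m x') (A' *m x') => u u' z z'.
  by rewrite !dotL; ring.
have h1 : dot ((A - A') *m w) (b - A *m x') <= (N * enorm w) * (M + M * X).
  apply: le_trans (dot_le_enorm _ _) _; apply: ler_pM; rewrite ?enorm_ge0 //.
  apply: le_trans (ler_enormB _ _) (lerD bM _).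
  by apply: le_trans (AM _) _; rewrite ler_wpM2l.
have h2 : dot (A' *m w) ((b - b') - (A - A') *m x') <= (M * enorm w) * (N + N * X).
  apply: le_trans (dot_le_enorm _ _) _; apply: ler_pM; rewrite ?enorm_ge0 //.
  apply: le_trans (ler_enormB _ _) (lerD bN _).
  by apply: le_trans (AN _) _; rewrite ler_wpM2l.
have h3 : - ((lam - lam') * dot w (signs R t)) <= N * (enorm w * n%:R).
  apply: le_trans (ler_norm _) _; rewrite normrN normrM; apply: ler_pM => //.
  by apply: le_trans (norm_dot_le_enorm _ _) _; rewrite ler_wpM2l ?enorm_ge0.
have h6 : (c * enorm w) ^+ 2 <= enorm (A *m w) ^+ 2.
  by rewrite ler_sqr ?nnegrE ?enorm_ge0 // mulr_ge0 ?enorm_ge0 // ltW.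
rewrite exprMn in h6.
have -> : enorm w * (enorm w * c ^+ 2) = c ^+ 2 * enorm w ^+ 2 by ring.
apply: le_trans h6 _; rewrite E.
have -> : enorm w * ((2 * M + 2 * M * X + n%:R) * N) = (N * enorm w) * (M + M * X)
  + (M * enorm w) * (N + N * X) + N * (enorm w * n%:R) by ring.
lra.
Qed.

Lemma residual_corr_lipschitz m n M (lam lam' : R) b (A : 'M[R]_(m, n)) x b' A' x' N X :
    0 <= M -> 0 <= N ->
    bounded_by M lam b A -> bounded_by M lam' b' A' -> enorm x <= X ->
    params_close N lam b A lam' b' A' ->
  enorm (residual_corr A b x - residual_corr A' b' x')
    <= (2 * M + 2 * M * X) * N + M ^+ 2 * enorm (x - x').
Proof.
move=> M0 N0 [_ bM AM] [_ _ A'M] xX [_ bN AN].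
have X0 : 0 <= X by apply: le_trans xX; apply: enorm_ge0.
have -> : residual_corr A b x - residual_corr A' b' x' =
    (A - A')^T *m (b - A *m x) + A'^T *m ((b - b') - (A - A') *m x - A' *m (x - x')).
  rewrite /residual_corr [(A - A')^T]linearB /= mulmxBl.
  rewrite -[LHS](subrKA (A'^T *m (b - A *m x))); congr (_ + _).
  rewrite -mulmxBr; congr (_ *m _); rewrite mulmxBl mulmxBr.
  move: (A *m x) (A' *m x) (A' *m x') => u v w.
  by apply/matrixP => i j; rewrite !mxE; ring.
apply: le_trans (enormD _ _) _.
have h1 : enorm ((A - A')^T *m (b - A *m x)) <= N * (M + M * X).
  apply: le_trans (enorm_trmx_mulmx_le N0 AN _) _; rewrite ler_wpM2l //.
  apply: le_trans (ler_enormB _ _) (lerD bM _).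
  by apply: le_trans (AM _) _; rewrite ler_wpM2l.
have h2 : enorm (A'^T *m ((b - b') - (A - A') *m x - A' *m (x - x')))
    <= M * (N + N * X + M * enorm (x - x')).
  apply: le_trans (enorm_trmx_mulmx_le M0 A'M _) _; rewrite ler_wpM2l //.
  apply: le_trans (ler_enormB _ _) (lerD _ (A'M _)).
  apply: le_trans (ler_enormB _ _) (lerD bN _).
  by apply: le_trans (AN _) _; rewrite ler_wpM2l.
have -> : (2 * M + 2 * M * X) * N + M ^+ 2 * enorm (x - x') =
  N * (M + M * X) + M * (N + N * X + M * enorm (x - x')) by ring.
exact: lerD.
Qed.

(** The inequalities in [optimal_branch] are weak, and both sides move
    Lipschitz-continuously with the parameters along a fixed branch. *)
Lemma optimal_branch_limit m n t c M lam b (A : 'M[R]_(m, n)) :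
    0 < c -> 0 <= M -> coercive_on A c t -> bounded_by M lam b A ->
    (forall e, 0 < e -> exists lam' b' A' x',
       [/\ coercive_on A' c t, bounded_by M lam' b' A',
           params_close e lam b A lam' b' A' & optimal_branch t lam' b' A' x']) ->
  exists x, optimal_branch t lam b A x.
Proof.
move=> c0 M0 Ac qM lim.
have [x xB] := branch_exists lam b (coercive_injective c0 Ac).
exists x; pose X := M * (M + n%:R) / c ^+ 2.
have X0 : 0 <= X by rewrite divr_ge0 ?sqr_ge0 // mulr_ge0 // addr_ge0.
pose K := (2 * M + 2 * M * X + n%:R) / c ^+ 2.
have MX0 : 0 <= M * X by rewrite mulr_ge0.
have n0 : 0 <= n%:R :> R by [].
have K0 : 0 <= K by apply: divr_ge0; [lra | exact: sqr_ge0].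
pose K' := (2 * M + 2 * M * X) + M ^+ 2 * K.
have K'0 : 0 <= K' by have := mulr_ge0 (sqr_ge0 M) K0; rewrite /K'; lra.
have key e : 0 < e -> forall i, - (K * e) <= signs R t i 0 * x i 0 /\
    `|residual_corr A b x i 0| <= lam + (1 + K') * e.
  move=> e0 i; have [lam' [b' [A' [x' [A'c q'M qq' [x'B x'O]]]]]] := lim e e0.
  have [sx rl] := x'O i; have [le _ _] := qq'.
  have xX := branch_bound c0 M0 Ac qM xB; have x'X := branch_bound c0 M0 A'c q'M x'B.
  have dx := branch_lipschitz c0 M0 (ltW e0) Ac qM q'M xB x'B x'X qq'.
  rewrite -/X -/K in xX x'X dx.
  have dr := residual_corr_lipschitz x' M0 (ltW e0) qM q'M xX qq'.
  have {}dr : enorm (residual_corr A b x - residual_corr A' b' x') <= K' * e.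
    have := ler_wpM2l (sqr_ge0 M) dx; rewrite /K'; lra.
  split.
    have dxi := le_trans (abs_coord_le_enorm (x - x') i) dx; rewrite !mxE in dxi.
    have : `|signs R t i 0 * (x' i 0 - x i 0)| <= K * e.
      rewrite normrM distrC; apply: le_trans dxi.
      by rewrite ler_piMl // normr_signs_le1.
    rewrite ler_norml => /andP[_]; rewrite mulrBr; lra.
  have dri := le_trans (abs_coord_le_enorm _ i) dr.
  rewrite [X in `|X|]mxE [X in _ + X]mxE in dri.
  have := ler_normD (residual_corr A b x i 0 - residual_corr A' b' x' i 0)
    (residual_corr A' b' x' i 0).
  rewrite subrK => h; move: le; rewrite ler_norml => /andP[le1 le2].
  have -> : lam + (1 + K') * e = lam + e + K' * e by ring.
  lra.
split=> // i; split.
  rewrite -[leLHS]oppr0 lerNl; apply/ler_addgt0Pl => e e0; rewrite addr0.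
  have K1 : 0 < K + 1 by rewrite ltr_wpDl.
  have [+ _] := key (e / (K + 1)) (divr_gt0 e0 K1) i.
  rewrite lerNl => /le_trans; apply; rewrite mulrA ler_pdivrMr // mulrC.
  by rewrite ler_pM2l // lerDl.
apply/ler_addgt0Pl => e e0.
have K1 : 0 < 1 + K' by rewrite ltr_pwDl.
have [_] := key (e / (1 + K')) (divr_gt0 e0 K1) i.
by rewrite mulrC divfK ?gt_eqF // addrC.
Qed.

End Stability.

(** * Gluing branches along segments *)

Section Gluing.
Variable R : realType.

(** Otherwise each alternative fails at some scale, and all of them fail at the
    smallest of these scales. *)
Lemma pigeonhole_scale (I : finType) (Q : I -> R -> Prop) :
  (forall i e e', e <= e' -> Q i e -> Q i e') ->
  (forall e, 0 < e -> exists i, Q i e) -> exists i, forall e, 0 < e -> Q i e.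
Proof.
move=> Qmon Qex; apply: contrapT => nQ.
have /choice[e eP] : forall i, exists e, 0 < e /\ ~ Q i e.
  move=> i; apply: contrapT => ne; apply: nQ; exists i => e e0.
  by apply: contrapT => nQe; apply: ne; exists e.
have d0 : 0 < \big[Num.min/1]_i e i.
  by apply: lt_bigmin => // i _; have [] := eP i.
have [i Qi] := Qex _ d0; have [_] := eP i; apply.
by apply: Qmon Qi; apply: bigmin_le_cond.
Qed.

(** Let [s] be the supremum of the times at which the bound from time 0 holds.
    Such times in one of the sets accumulate at [s], which then lies in that set,
    so the bound holds at [s].  If [s < 1], one of the sets also contains times
    accumulating at [s] from the right, hence [s], and the bound extends past
    [s]. *)
Lemma lipschitz_closed_cover (I : finType) n (V : I -> R -> Prop)
    (f : R -> 'cV[R]_n) L :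
    (forall t, 0 <= t <= 1 -> exists i, V i t) ->
    (forall i s, 0 <= s <= 1 ->
       (forall e, 0 < e -> exists t, [/\ 0 <= t <= 1, V i t & `|s - t| <= e]) ->
       V i s) ->
    (forall i s t, 0 <= s <= 1 -> 0 <= t <= 1 -> V i s -> V i t ->
       enorm (f s - f t) <= L * `|s - t|) ->
  enorm (f 1 - f 0) <= L.
Proof.
move=> Vcov Vcl VL.
pose E := [set t | 0 <= t <= 1 /\ enorm (f t - f 0) <= L * t].
have E0 : E 0 by split; rewrite ?lexx ?ler01 // subrr enorm0 mulr0.
have Eub : has_ubound E by exists 1 => t [/andP[]].
have Es : has_sup E by split=> //; exists 0.
set s := sup E.
have s0 : 0 <= s by apply: ub_le_sup.
have s1 : s <= 1 by apply: ge_sup => [|t [/andP[]]]; first by exists 0.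
have s01 : 0 <= s <= 1 by rewrite s0 s1.
have step a b i : E a -> a <= b -> 0 <= b <= 1 -> V i a -> V i b -> E b.
  move=> [a01 Ea] ab b01 Va Vb; split=> //.
  have := VL i b a b01 a01 Vb Va; rewrite ger0_norm ?subr_ge0 // => ba.
  have := enormD (f b - f a) (f a - f 0); rewrite addrA subrK => tri.
  have -> : L * b = L * (b - a) + L * a by ring.
  exact: le_trans tri (lerD ba Ea).
have Esup : E s.
  have [i Vi] : exists i, forall e, 0 < e ->
      exists t, [/\ E t, V i t & `|s - t| <= e].
    apply: pigeonhole_scale => [i e e' ee' [t [Et Vt st]]|e e0].
      by exists t; split=> //; apply: le_trans ee'.
    have [t Et st] := sup_adherent e0 Es.
    have [i Vt] := Vcov t (proj1 Et); exists i, t; split=> //.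
    have ts : t <= s := ub_le_sup Eub Et.
    by rewrite ger0_norm ?subr_ge0 // lerBlDr -lerBlDl ltW.
  have Vs : V i s.
    by apply: Vcl => // e /Vi[t [[t01 _] Vt st]]; exists t.
  have [t [Et Vt _]] := Vi 1 ltr01.
  by apply: (step t s i) => //; exact: (ub_le_sup Eub Et).
have [s_eq1|sn1] := eqVneq s 1; first by case: Esup; rewrite s_eq1 mulr1.
have {sn1}s_lt1 : s < 1 by rewrite lt_neqAle sn1.
have [i Vi] : exists i, forall e, 0 < e ->
    exists t, [/\ 0 <= t <= 1, V i t, s < t & `|s - t| <= e].
  apply: pigeonhole_scale => [i e e' ee' [t [t01 Vt st te]]|e e0].
    by exists t; split=> //; apply: le_trans ee'.
  pose t := Num.min 1 (s + e).
  have st : s < t by rewrite lt_min s_lt1 ltrDl.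
  have t01 : 0 <= t <= 1 by rewrite (le_trans s0 (ltW st)) ge_min lexx.
  have [i Vt] := Vcov t t01; exists i, t; split=> //.
  rewrite distrC ger0_norm ?subr_ge0 ?(ltW st) // lerBlDl.
  by rewrite ge_min lexx orbT.
have Vs : V i s by apply: Vcl => // e /Vi[t [t01 Vt _ st]]; exists t.
have [t [t01 Vt st _]] := Vi 1 ltr01.
have Et : E t by apply: (step s t i) => //; exact: ltW.
by have := ub_le_sup Eub Et; rewrite leNgt st.
Qed.

(** The common core of the two sets of hypotheses at a matrix [A]: every sign
    pattern of a dual feasible point lies in [T], the active columns of the
    patterns in [T] are uniformly independent, and the least squares problem has
    residual zero or a unique solution. *)
Definition regular m n (T : set (triple n)) c (A : 'M[R]_(m, n)) :=
  [/\ J A `<=` T, T `<=` @index_partition n,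
      forall t, T t -> coercive_on A c t
    & (forall v : 'cV[R]_n, A *m v = 0 -> v = 0) \/
      ((forall y : 'cV[R]_m, A^T *m y = 0 -> y = 0) /\ T `<=` J A)].

Lemma regular_normal_equation m n T c (A : 'M[R]_(m, n)) b : regular T c A ->
  exists z : 'cV[R]_n, A^T *m (b - A *m z) = 0.
Proof.
move=> [_ _ _ [Ainj|[Asurj _]]].
  exact: normal_equation_solvable_injective.
exact: normal_equation_solvable_surjective.
Qed.

(** At [lam = 0] the two alternatives in [regular] give uniqueness for different
    reasons: the constraint set is a singleton, or the residual is zero and [J A]
    supplies the certificate. *)
Lemma regular_solution m n T c (A : 'M[R]_(m, n)) lam b t x :
    0 < c -> 0 <= lam -> regular T c A -> T t -> optimal_branch t lam b A x ->
  solution lam b A = [set x].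
Proof.
move=> c0 lam0 Areg Tt xO; have [z Az] := regular_normal_equation b Areg.
have [JT Tpart Tc A0] := Areg.
have Tinj t' : T t' -> active_injective A t' by move=> /Tc; apply: coercive_injective.
move: lam0; rewrite le_eqVlt => /predU1P[lam0|lam0]; last first.
  by apply: (optimal_branch_solution_pos lam0 (Tpart t Tt) Az) xO => t' /JT/Tinj.
rewrite -lam0 in xO *; case: A0 => [Ainj|[Asurj TJ]].
  exact: optimal_branch_solution0_injective xO.
by apply: optimal_branch_solution0_surjective xO => //; [exact: TJ | exact: Tinj].
Qed.

(** For [lam = 0], some triple is optimal for arbitrarily small positive
    parameters, and optimality of its branch passes to the limit. *)
Lemma regular_optimal_branch_exists m n T c M (A : 'M[R]_(m, n)) lam b :
    0 < c -> 0 <= lam -> regular T c A -> bounded_by M lam b A ->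
  exists t, T t /\ exists x, optimal_branch t lam b A x.
Proof.
move=> c0 lam0 Areg qM; have [z Az] := regular_normal_equation b Areg.
have [JT Tpart Tc _] := Areg.
have pos l : 0 < l -> exists t, T t /\ exists x, optimal_branch t l b A x.
  move=> l0; have [t [x [/JT Tt xO]]] := optimal_branch_exists_pos l0 Az.
  by exists t; split=> //; exists x.
move: lam0; rewrite le_eqVlt => /predU1P[lam0|/pos //].
rewrite -lam0 in qM *; have [M0 bM AM] := qM; rewrite normr0 in M0.
have [t Ht] : exists t : triple n, forall e, 0 < e -> T t /\
    exists l x, [/\ 0 < l, l <= e, l <= 1 & optimal_branch t l b A x].
  apply: pigeonhole_scale => [t e e' ee' [Tt [l [x [l0 le l1 xO]]]]|e e0].
    by split=> //; exists l, x; split=> //; apply: le_trans ee'.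
  have l0 : 0 < Num.min e 1 by rewrite lt_min e0 ltr01.
  have [t [Tt [x xO]]] := pos _ l0; exists t; split=> //; exists (Num.min e 1), x.
  by split=> //; rewrite ge_min lexx ?orbT.
have [Tt _] := Ht 1 ltr01; exists t; split=> //.
(* [M + 1] also bounds the auxiliary parameters [l <= 1] *)
have M1 : 0 <= M + 1 by rewrite addr_ge0.
have AM1 v : enorm (A *m v) <= (M + 1) * enorm v.
  by apply: le_trans (AM v) _; rewrite ler_wpM2r ?enorm_ge0 // lerDl.
apply: (optimal_branch_limit c0 M1) => //; first exact: Tc.
  by split=> //; [rewrite normr0 | rewrite (le_trans bM) // lerDl].
move=> e e0; have [_ [l [x [l0 le l1 xO]]]] := Ht e e0.
exists l, b, A, x; split=> //; first exact: Tc.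
  split=> //; last by rewrite (le_trans bM) // lerDl.
  by rewrite gtr0_norm // (le_trans l1) // lerDr.
split; first by rewrite sub0r normrN gtr0_norm.
  by rewrite subrr enorm0 ltW.
by move=> v; rewrite subrr mul0mx enorm0 mulr_ge0 ?enorm_ge0 // ltW.
Qed.

Lemma param_norm_ge m n (p : (R^o * 'cV[R]_m) * 'M[R]_(m, n)) :
  [/\ `|p.1.1| <= param_norm p, enorm p.1.2 <= param_norm p
    & specnorm p.2 <= param_norm p].
Proof.
have N0 : 0 <= param_norm p by exact: sqrtr_ge0.
have NE : param_norm p ^+ 2 = p.1.1 ^+ 2 + enorm p.1.2 ^+ 2 + specnorm p.2 ^+ 2.
  by rewrite sqr_sqrtr // !addr_ge0 // sqr_ge0.
have h1 := sqr_ge0 (p.1.1 : R); have h2 := sqr_ge0 (enorm p.1.2).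
have h3 := sqr_ge0 (specnorm p.2).
split; rewrite -ler_sqr ?nnegrE ?enorm_ge0 ?specnorm_ge0 // NE.
- by rewrite real_normK ?num_real // -addrA lerDl addr_ge0.
- by rewrite addrAC lerDr addr_ge0.
- by rewrite lerDr addr_ge0.
Qed.

(** On a segment of parameters the sets where the branch of a given triple is
    optimal are closed and cover; on each of them the solution is that branch. *)
Lemma regular_lipschitz m n (X : set ((R^o * 'cV[R]_m) * 'M[R]_(m, n))) T c M :
    0 < c -> 0 <= M ->
    (forall p, X p -> [/\ 0 <= p.1.1, regular T c p.2 & bounded_by M p.1.1 p.1.2 p.2]) ->
    (forall p p' s, X p -> X p' -> 0 <= s <= 1 -> X (p + s *: (p' - p))) ->
  single_valued_on X (@solution_map R m n) /\
  lipschitz_multifunction (@param_norm R m n) X (@solution_map R m n).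
Proof.
move=> c0 M0 XP Xconv.
pose opt t (p : (R^o * 'cV[R]_m) * 'M[R]_(m, n)) x := optimal_branch t p.1.1 p.1.2 p.2 x.
have sol p t x : X p -> T t -> opt t p x -> solution_map p = [set x].
  by move=> /XP[p0 preg _] Tt; apply: regular_solution p0 preg Tt.
have ex p : X p -> exists t, T t /\ exists x, opt t p x.
  by move=> /XP[p0 preg pM]; apply: regular_optimal_branch_exists p0 preg pM.
have sv p : X p -> exists x, solution_map p = [set x].
  by move=> Xp; have [t [Tt [x /(sol p t x Xp Tt)]]] := ex p Xp; exists x.
split=> //; split.
  move=> p /sv[x ->]; split; first by exists x.
  apply: accessible_closed_set1; apply: hausdorff_accessible.
  exact: norm_hausdorff.
pose B := M * (M + n%:R) / c ^+ 2; pose k := (2 * M + 2 * M * B + n%:R) / c ^+ 2.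
have B0 : 0 <= B by rewrite divr_ge0 ?sqr_ge0 // mulr_ge0 // addr_ge0.
have MB0 : 0 <= M * B by rewrite mulr_ge0.
have n0 : 0 <= n%:R :> R by [].
have k0 : 0 <= k by apply: divr_ge0; [lra | exact: sqr_ge0].
exists k => // p p' Xp Xp' x' x'p'.
pose q (s : R) := p + s *: (p' - p).
have Xq s : 0 <= s <= 1 -> X (q s) by move=> s01; apply: Xconv.
pose f s := xget 0 (solution_map (q s)).
have fE s x : solution_map (q s) = [set x] -> f s = x.
  by move=> E; rewrite /f E; apply: xget_unique.
set N := param_norm (p' - p); have N0 : 0 <= N by exact: sqrtr_ge0.
have qdist (s t : R) : params_close (`|s - t| * N) (q s).1.1 (q s).1.2 (q s).2
    (q t).1.1 (q t).1.2 (q t).2.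
  have [h1 h2 h3] := param_norm_ge (p' - p).
  split=> [||v] /=; rewrite [X in X - _]addrC addrKA -?mulrBl -?scalerBl.
  - by rewrite normrM ler_wpM2l.
  - by rewrite enormZ ler_wpM2l.
  - rewrite -scalemxAl enormZ -mulrA ler_wpM2l //.
    by apply: le_trans (enorm_mulmx_le _ _) _; rewrite ler_wpM2r ?enorm_ge0.
have fL : enorm (f 1 - f 0) <= k * N.
  apply: (@lipschitz_closed_cover _ _ (fun t s => T t /\ exists x, opt t (q s) x)).
  - by move=> s s01; exact: ex (Xq s s01).
  - move=> t s s01 lim; have [_ [_ [Tt _] _]] := lim 1 ltr01.
    split=> //; have [_ [_ _ sc _] sM] := XP _ (Xq s s01).
    apply: (optimal_branch_limit c0 M0 (sc t Tt) sM) => e e0.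
    have N1 : 0 < N + 1 by rewrite ltr_wpDl.
    have [u [u01 [_ [x xO]] su]] := lim (e / (N + 1)) (divr_gt0 e0 N1).
    have [_ [_ _ uc _] uM] := XP _ (Xq u u01).
    exists (q u).1.1, (q u).1.2, (q u).2, x; split=> //; first exact: uc.
    have suN : `|s - u| * N <= e.
      rewrite ler_pdivlMr // in su; apply: le_trans su.
      by rewrite ler_wpM2l // lerDl.
    have [d1 d2 d3] := qdist s u; split=> [||v].
    + exact: le_trans d1 suN.
    + exact: le_trans d2 suN.
    + by apply: le_trans (d3 v) _; rewrite ler_wpM2r ?enorm_ge0.
  move=> t s u s01 u01 [Tt [x xO]] [_ [y yO]].
  rewrite (fE s x (sol _ _ _ (Xq s s01) Tt xO)) (fE u y (sol _ _ _ (Xq u u01) Tt yO)).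
  have [_ [_ _ sc _] sM] := XP _ (Xq s s01).
  have [_ [_ _ uc _] uM] := XP _ (Xq u u01).
  have yB := branch_bound c0 M0 (uc t Tt) uM yO.1.
  have := branch_lipschitz c0 M0 (mulr_ge0 (normr_ge0 _) N0) (sc t Tt) sM uM xO.1 yO.1 yB
    (qdist s u).
  by rewrite -/B -/k => h; apply: le_trans h _; rewrite -(mulrA k N) (mulrC N).
have [x px] := sv p Xp.
have f0 : f 0 = x by apply: fE; rewrite /q scale0r addr0.
have f1 : f 1 = x'.
  have [y py] := sv p' Xp'; move: x'p'; rewrite py => ->.
  by apply: fE; rewrite /q scale1r addrC subrK.
rewrite f0 f1 in fL.
exists x; first by rewrite px.
have [d0|dn0] := eqVneq (k * N) 0.
  exists 0; first exact: unit_ball0.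
  move: fL; rewrite d0 scaler0 addr0 => h; apply/eqP.
  by rewrite eq_sym -subr_eq0 -enorm_eq0 eq_le h enorm_ge0.
exists ((k * N)^-1 *: (x' - x)).
  have kN0 : 0 < k * N by rewrite lt_def dn0 (mulr_ge0 k0 N0).
  rewrite /unit_ball /= enormZ gtr0_norm ?invr_gt0 //.
  by rewrite mulrC ler_pdivrMr ?mul1r.
by rewrite scalerA divff // scale1r addrC subrK.
Qed.

End Gluing.

(** * The two sets of hypotheses *)

Section Conditions.
Variable R : realType.

Lemma colset_mulmx_eq0 m n (A : 'M[R]_(m, n)) (K : {set 'I_n}) (y : 'cV[R]_m) :
  y^T *m colset A K = 0 <-> forall i, i \in K -> (A^T *m y) i 0 = 0.
Proof.
have E k : (y^T *m colset A K) 0 k = (A^T *m y) (enum_val k) 0.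
  by rewrite !mxE; apply: eq_bigr => j _; rewrite !mxE mulrC.
split=> [yA i iK|yA].
  by rewrite -(enum_rankK_in iK iK) -E yA [LHS]mxE.
by apply/matrixP => j k; rewrite ord1 E [RHS]mxE yA // enum_valP.
Qed.

(** The rank condition in [J0] is independence of the active columns. *)
Lemma J0_active_injective m n (A : 'M[R]_(m, n)) t : J0 A t -> active_injective A t.
Proof.
case: t => [[Ip I0] Im] [_ rk] v; rewrite /active /=.
move: rk; set K := Ip :|: Im => -[K0|rk] vK Av.
  by apply/matrixP => i j; rewrite ord1 mxE vK // K0 inE.
pose w : 'cV[R]_#|K| := \col_k v (enum_val k) 0.
have Aw : colset A K *m w = 0.
  rewrite -Av; apply/matrixP => i j; rewrite ord1 !mxE.
  rewrite [RHS](bigID (fun k => k \in K)) /= [X in _ + X]big1 ?addr0; last first.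
    by move=> k kK; rewrite vK ?mulr0.
  rewrite [RHS]big_enum_val /=; apply: eq_bigr => k _; rewrite !mxE //.
have /eqP := congr1 trmx Aw; rewrite trmx_mul trmx0 mulmx_free_eq0; last first.
  by rewrite /row_free mxrank_tr rk.
move=> /eqP/(congr1 trmx); rewrite trmxK trmx0 => w0.
apply/matrixP => i j; rewrite ord1 [RHS]mxE.
have [iK|iK] := boolP (i \in K); last exact: vK.
have := congr1 (fun M : 'cV[R]_#|K| => M (enum_rank_in iK i) 0) w0.
by rewrite !mxE enum_rankK_in.
Qed.

Lemma full_rank_trmx_injective m n (A : 'M[R]_(m, n)) : \rank A = m ->
  forall y : 'cV[R]_m, A^T *m y = 0 -> y = 0.
Proof.
move=> rk y /(congr1 trmx)/eqP; rewrite trmx_mul trmxK trmx0 mulmx_free_eq0.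
  by move=> /eqP/(congr1 trmx); rewrite trmxK trmx0.
by rewrite /row_free rk.
Qed.

Definition dual_vertex m n (A : 'M[R]_(m, n)) (y : 'cV[R]_m) :=
  (forall i, `|(A^T *m y) i 0| <= 1) /\
  forall d : 'cV[R]_m,
    (forall i, `|(A^T *m y) i 0| = 1 -> (A^T *m d) i 0 = 0) -> d = 0.

Definition tight m n (A : 'M[R]_(m, n)) (y : 'cV[R]_m) : {set 'I_n} :=
  [set i | `|(A^T *m y) i 0| == 1]%SET.

(** The new point is reached from [y] along [d], a direction invisible to the
    constraints tight at [y], when the first other constraint becomes tight. *)
Lemma tighten m n (A : 'M[R]_(m, n)) (y d : 'cV[R]_m) :
    (forall i, `|(A^T *m y) i 0| <= 1) ->
    (forall i, `|(A^T *m y) i 0| = 1 -> (A^T *m d) i 0 = 0) ->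
    A^T *m d != 0 ->
  exists y' : 'cV[R]_m, (forall i, `|(A^T *m y') i 0| <= 1) /\
    tight A y \proper tight A y'.
Proof.
set g := A^T *m y; set dl := A^T *m d => g1 gd dl0.
have [j dj] : exists j, dl j 0 != 0.
  apply: contrapT => nj; move/negP: dl0; apply; apply/eqP/matrixP => i k.
  rewrite ord1 [RHS]mxE; apply/eqP/negPn/negP => di; apply: nj.
  by exists i.
(* the step at which constraint [i] becomes tight along [d] *)
pose st i := (1 - Num.sg (dl i 0) * g i 0) / `|dl i 0|.
have [i0 di0 stmin] := @arg_minP _ _ _ j (fun i => dl i 0 != 0) st dj.
have g1' i : -1 <= g i 0 <= 1 by rewrite -ler_norml.
have st0 : 0 <= st i0.
  rewrite divr_ge0 // subr_ge0; apply: le_trans (ler_norm _) _.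
  by rewrite normrM normr_sg di0 mul1r.
have E i : (A^T *m (y + st i0 *: d)) i 0 = g i 0 + st i0 * dl i 0.
  by rewrite mulmxDr -scalemxAr -/g -/dl [LHS]mxE [X in _ + X]mxE.
exists (y + st i0 *: d); split=> [i|].
  rewrite E; have [->|di] := eqVneq (dl i 0) 0; first by rewrite mulr0 addr0.
  have := stmin i di; rewrite {2}/st ler_pdivlMr ?normr_gt0 //.
  have /andP[gl gu] := g1' i; rewrite ler_norml.
  case: (ltgtP (dl i 0) 0) di => // dlt _.
    by rewrite ltr0_sg // ltr0_norm // => h; apply/andP; split; nra.
  by rewrite gtr0_sg // gtr0_norm // => h; apply/andP; split; nra.
apply/properP; split.
  apply/fintype.subsetP => i; rewrite !inE => /eqP gi.
  by rewrite E gd // mulr0 addr0 gi.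
exists i0; rewrite !inE; last first.
  by apply: contra di0 => /eqP di; rewrite gd.
have : st i0 * `|dl i0 0| = 1 - Num.sg (dl i0 0) * g i0 0.
  by rewrite /st divfK // normr_eq0.
rewrite E; case: (ltgtP (dl i0 0) 0) di0 => // dlt _.
  rewrite ltr0_sg // ltr0_norm // => h.
  have -> : g i0 0 + st i0 * dl i0 0 = -1 by lra.
  by rewrite normrN1.
rewrite gtr0_sg // gtr0_norm // => h.
have -> : g i0 0 + st i0 * dl i0 0 = 1 by lra.
by rewrite normr1.
Qed.

(** Tighten from the origin until the tight constraints span; each step enlarges
    a subset of ['I_n]. *)
Lemma dual_vertex_exists m n (A : 'M[R]_(m, n)) :
    (forall y : 'cV[R]_m, A^T *m y = 0 -> y = 0) ->
  exists y, dual_vertex A y.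
Proof.
move=> Asurj.
suff H k (y : 'cV[R]_m) : (forall i, `|(A^T *m y) i 0| <= 1) ->
    (n - #|tight A y| <= k)%N ->
    exists y, dual_vertex A y.
  by apply: (H n 0); [move=> i; rewrite mulmx0 mxE normr0 | rewrite leq_subr].
elim: k y => [|k IH] y y1 yk.
all: have [//|nv] := pselect (forall d : 'cV[R]_m,
    (forall i, `|(A^T *m y) i 0| = 1 -> (A^T *m d) i 0 = 0) -> d = 0);
  first by exists y.
all: have [d [dy d0]] : exists d : 'cV[R]_m,
    (forall i, `|(A^T *m y) i 0| = 1 -> (A^T *m d) i 0 = 0) /\ A^T *m d != 0
  by apply: contrapT => nd; apply: nv => d dy; apply: Asurj;
     apply/eqP/negPn/negP => d0; apply: nd; exists d.
all: have [y' [y'1 /proper_card lt]] := tighten y1 dy d0.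
all: have le : (#|tight A y'| <= n)%N by rewrite -[leqRHS]card_ord max_card.
- by move: yk; rewrite leqn0 subn_eq0 leqNgt (leq_trans lt le).
- apply: (IH y' y'1); rewrite -ltnS; apply: leq_trans yk.
  by rewrite ltn_sub2l // (leq_trans lt le).
Qed.

(** The active columns of a vertex of [A] span the space, and by [J0 A] they are
    independent, so there are [m] of them; by [J0 B] the corresponding columns of
    [B] are independent as well. *)
Lemma vertex_rank_transfer m n (A B : 'M[R]_(m, n)) : \rank A = m ->
  J A `<=` J0 A -> J A `<=` J0 B -> forall y : 'cV[R]_m, B^T *m y = 0 -> y = 0.
Proof.
move=> rk JA JB y By.
have [v [v1 vext]] := dual_vertex_exists (full_rank_trmx_injective rk).
set t := sign_triple (A^T *m v); have tJ : J A t by exact: sign_triple_J.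
have [_ tA] := JA _ tJ; have [_ tB] := JB _ tJ.
have actE i : (i \in active t) = (`|(A^T *m v) i 0| == 1).
  by rewrite /active !inE eqr_norml ler01 andbT.
have spanA (d : 'cV[R]_m) : d^T *m colset A (active t) = 0 -> d = 0.
  move=> /colset_mulmx_eq0 dA; apply: vext => i /eqP; rewrite -actE; exact: dA.
case: tA => [t0|tA].
  apply: vext => i /eqP; rewrite -actE /active /=.
  by rewrite (_ : _ :|: _ = finset.set0) ?inE.
have tm : #|active t| = m.
  rewrite -tA; apply/eqP; rewrite -/(row_free _); apply: inj_row_free => d dA.
  by rewrite -[d]trmxK (spanA d^T) ?trmx0 // trmxK.
case: tB => [t0|tB].
  apply: vext => i /eqP; rewrite -actE /active /=.
  by rewrite (_ : _ :|: _ = finset.set0) ?inE.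
have : y^T *m colset B (active t) = 0.
  by apply/colset_mulmx_eq0 => i _; rewrite By mxE.
move=> /eqP; rewrite mulmx_free_eq0; last first.
  by rewrite /row_free [\rank _]tB -[X in _ == X]tm.
by move=> /eqP/(congr1 trmx); rewrite trmxK trmx0.
Qed.

(** Distance to degeneracy: if [A v] were short, the rank one correction
    [A - (A v) v^T / |v|^2] would stay in the larger ball and kill [v]. *)
Lemma coercive_of_injective_ball m n (A0 A : 'M[R]_(m, n)) t a g :
    0 <= a -> a < g ->
    (forall B, spec_ball A0 g B -> active_injective B t) ->
    spec_ball A0 a A ->
  coercive_on A (g - a) t.
Proof.
move=> a0 ag inj Aa v vt; rewrite leNgt; apply/negP => lt.
have v0 : 0 < enorm v.
  rewrite enorm_gt0; apply: contraTneq lt => ->.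
  by rewrite mulmx0 !enorm0 mulr0 ltxx.
pose B := A - (enorm v ^- 2) *: ((A *m v) *m v^T).
have BE x : B *m x = A *m x - (enorm v ^- 2 * dot v x) *: (A *m v).
  rewrite mulmxBl -scalemxAl -(mulmxA (A *m v)) [v^T *m x]mx11_scalar -/(dot v x).
  by rewrite mul_mx_scalar scalerA.
have Bv : B *m v = 0.
  by rewrite BE -sqr_enorm mulVf ?expf_eq0 ?gt_eqF // scale1r subrr.
have B_ball : spec_ball A0 g B.
  have g0 : 0 <= g by exact: le_trans a0 (ltW ag).
  apply/spec_ballP => // x; move/(spec_ballP _ _ a0): Aa => Aa.
  have -> : (B - A0) *m x = (A - A0) *m x - (enorm v ^- 2 * dot v x) *: (A *m v).
    by rewrite mulmxBl BE mulmxBl addrAC.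
  apply: le_trans (ler_enormB _ _) _; rewrite enormZ normrM.
  have -> : g * enorm x = a * enorm x + (g - a) * enorm x by ring.
  apply: lerD => //.
  rewrite ger0_norm ?invr_ge0 ?sqr_ge0 // -mulrA ler_pdivrMl ?exprn_gt0 //.
  have := norm_dot_le_enorm v x; move/ltW: lt => h1 h2.
  have -> : enorm v ^+ 2 * ((g - a) * enorm x)
    = (enorm v * enorm x) * ((g - a) * enorm v) by ring.
  by apply: ler_pM; rewrite ?enorm_ge0.
by move: v0; rewrite (inj B B_ball v vt Bv) enorm0 ltxx.
Qed.

(** A minimizer of the Rayleigh quotient is an eigenvector of the Gram matrix, so
    the minimum of [|A v| / |v|] is a singular value. *)
Lemma sigma_min_le m n (A : 'M[R]_(m, n)) v : (n <= m)%N ->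
  sigma_min A * enorm v <= enorm (A *m v).
Proof.
move=> nm; have [->|v0] := eqVneq v 0; first by rewrite mulmx0 !enorm0 mulr0.
have {}v0 : 0 < enorm v by rewrite enorm_gt0.
have e1C : continuous (@enorm R n).
  move=> x; have := @enorm_affine_continuous R n n 1%:M 0 x.
  by rewrite (_ : (fun x => _) = @enorm R n) //; apply/funext => z; rewrite mul1mx subr0.
have nE (w : 'cV[R]_n) : 0 < enorm w -> enorm ((enorm w)^-1 *: w) = 1.
  by move=> w0; rewrite enormZ gtr0_norm ?invr_gt0 // mulVf // gt_eqF.
have [u [u1 umin]] :
    argmin [set x : 'cV[R]_n | enorm x = 1] (fun x => enorm (A *m x)) !=set0.
  apply: (@argmin_closed_bounded _ _ _ _ 1).
  - by exists ((enorm v)^-1 *: v); rewrite /= nE.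
  - by apply: preimage_closed (@closed_eq _ _) => x _; apply: e1C.
  - by move=> x /= ->.
  - move=> x; have := @enorm_affine_continuous R m n A 0 x.
    rewrite (_ : (fun x => _) = (fun x => enorm (A *m x))) //.
    by apply/funext => z; rewrite subr0.
set s := enorm (A *m u).
have ray w : s * enorm w <= enorm (A *m w).
  have [->|w0] := eqVneq w 0; first by rewrite mulmx0 !enorm0 mulr0.
  have {}w0 : 0 < enorm w by rewrite enorm_gt0.
  have := umin _ (nE w w0); rewrite -scalemxAr enormZ gtr0_norm ?invr_gt0 //.
  by rewrite mulrC ler_pdivlMr.
apply: le_trans (ray v); rewrite ler_pM2r //.
apply: ge_inf; first by exists 0 => x [].
split; first exact: enorm_ge0.
rewrite nm; apply/eigenvalueP; exists u^T; last first.
  apply: contra_eq_neq u1 => /(congr1 trmx); rewrite trmxK trmx0 => ->.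
  by rewrite enorm0 eq_sym oner_neq0.
suff r0 : A^T *m (A *m u) - s ^+ 2 *: u = 0.
  apply: trmx_inj; rewrite trmx_mul trmx_mul !trmxK linearZ /= trmxK -mulmxA.
  by apply/eqP; rewrite -subr_eq0 r0.
set r := (X in X = 0).
have rrE : dot r r = dot (A *m r) (A *m u) - s ^+ 2 * dot r u.
  by rewrite {2}/r dotDr dotNr dotZr dot_mulmx.
clearbody r.
(* the quadratic form [Q] is nonnegative and vanishes at [u], so its gradient,
   twice [r], vanishes there *)
pose Q w := dot (A *m w) (A *m w) - s ^+ 2 * dot w w.
have Q0 w : 0 <= Q w.
  rewrite /Q -!sqr_enorm -exprMn subr_ge0 ler_sqr ?nnegrE ?mulr_ge0 ?enorm_ge0 //.
have QE th : Q (u + th *: r) = 2 * th * dot r r + th ^+ 2 * Q r.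
  rewrite /Q mulmxDr -scalemxAr.
  have := sqr_enorm u; rewrite u1 => u1'; have := sqr_enorm (A *m u).
  rewrite -/s => sE.
  rewrite !dotL rrE (dotC (A *m u) (A *m r)) (dotC u r) -sE -u1'; ring.
have r_ge0 := dot_ge0 r.
have rr : dot r r <= 0.
  rewrite leNgt; apply/negP => r_gt0.
  pose th := dot r r / (Q r + 1).
  have q1 : 0 < Q r + 1 by rewrite ltr_wpDl.
  have th0 : 0 < th by rewrite divr_gt0.
  have thE : th * (Q r + 1) = dot r r by rewrite divfK // gt_eqF.
  have := Q0 (u + (- th) *: r); rewrite QE sqrrN => h.
  have : th * (th * Q r - 2 * dot r r) >= 0 by lra.
  rewrite pmulr_rge0 //; nra.
by apply/eqP; rewrite -dot_eq0 eq_le rr r_ge0.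
Qed.

Lemma spec_ball_convex m n (A0 A B : 'M[R]_(m, n)) r s : 0 <= r -> 0 <= s <= 1 ->
  spec_ball A0 r A -> spec_ball A0 r B -> spec_ball A0 r (A + s *: (B - A)).
Proof.
move=> r0 /andP[s0 s1] /(spec_ballP _ _ r0) Ar /(spec_ballP _ _ r0) Br.
apply/spec_ballP => // x.
have -> : (A + s *: (B - A) - A0) *m x =
    (1 - s) *: ((A - A0) *m x) + s *: ((B - A0) *m x).
  rewrite !mulmxBl mulmxDl -scalemxAl mulmxBl.
  move: (A *m x) (B *m x) (A0 *m x) => a b c.
  by apply/matrixP => i j; rewrite !mxE; ring.
apply: le_trans (enormD _ _) _; rewrite !enormZ !ger0_norm ?subr_ge0 //.
have := Ar x; have := Br x => h1 h2.
have -> : r * enorm x = (1 - s) * (r * enorm x) + s * (r * enorm x) by ring.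
by apply: lerD; rewrite ler_wpM2l // subr_ge0.
Qed.

Lemma convex_set_segment (V : lmodType R) (U : set V) (u v : V) s :
  convex_set U -> U u -> U v -> 0 <= s <= 1 -> U (u + s *: (v - u)).
Proof.
move=> Uc Uu Uv /andP[s0 s1].
have := Uc v u (Itv01 s0 s1) (mem_set Uv) (mem_set Uu) => /set_mem.
rewrite /conv /= => h.
have -> : u + s *: (v - u) = s *: v + (1 - s) *: u; last exact: h.
by rewrite scalerBr scalerBl scale1r addrCA addrC -addrA [- _ + _]addrC addrA.
Qed.

Lemma compact_params_bounded m (U : set (R^o * 'cV[R]_m)) : compact U ->
  exists2 M, 0 <= M & forall u, U u -> `|u.1| <= M /\ enorm u.2 <= M.
Proof.
move=> /compact_bounded [M [_ UM]].
have M0 : 0 <= `|M| + 1 by rewrite addr_ge0.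
have UM1 u : U u -> `|u.1| <= `|M| + 1 /\ `|u.2| <= `|M| + 1.
  have ltM : M < `|M| + 1 by rewrite (le_lt_trans (ler_norm M)) // ltrDl.
  by move=> Uu; have /= := UM _ ltM u Uu; rewrite prod_normE ge_max => /andP.
exists (m.+1%:R * (`|M| + 1)); first by rewrite mulr_ge0.
move=> u /UM1[h1 h2]; split.
  by apply: le_trans h1 _; rewrite ler_peMl // ler1n.
apply: le_trans (enorm_le_mx_norm _) _; apply: ler_pM => //.
by rewrite ler_nat.
Qed.

End Conditions.

Unset Implicit Arguments.
Unset Strict Implicit.

Theorem theorem4p2 (R : realType) (m n : nat) (Abar : 'M[R]_(m, n))
    (U : set (R^o * 'cV[R]_m)) (alpha : R)
    (U_nonempty : U !=set0)
    (U_compact : compact U)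
    (U_convex : convex_set U)
    (U_nonneg : forall p, U p -> 0 <= p.1)
    (H : [/\ \rank Abar = m, J0 Abar = J Abar, 0 < alpha
           & (alpha%:E < kappa Abar)%E]
         \/ [/\ \rank Abar = n, 0 < alpha & alpha < sigma_min Abar]) :
  single_valued_on (U `*` spec_ball Abar alpha) (@solution_map R m n) /\
  lipschitz_multifunction (@param_norm R m n)
    (U `*` spec_ball Abar alpha) (@solution_map R m n).
Proof.
have alpha0 : 0 <= alpha by case: H => [[_ _ /ltW]|[_ /ltW]].
have [T [c [c0 Areg]]] : exists T c, 0 < c /\
    forall A, spec_ball Abar alpha A -> regular T c A.
  case: H => [[rk J0J _ /ereal_sup_gt[_ [g [g0 gP] <-]]]|[rk _ asig]].
    rewrite lte_fin => ag; exists (J Abar), (g - alpha); split; first by rewrite subr_gt0.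
    have Jinj t B : J Abar t -> spec_ball Abar g B -> active_injective B t.
      by move=> tJ /gP[BJ JE]; apply: J0_active_injective; rewrite BJ JE.
    move=> A Aa; have Ag : spec_ball Abar g A by exact: le_trans Aa (ltW ag).
    have [AJ JE] := gP A Ag; split.
    - by rewrite JE.
    - by move=> t [].
    - by move=> t tJ; apply: coercive_of_injective_ball Aa => // B; apply: Jinj.
    right; split; last by rewrite JE.
    by apply: (vertex_rank_transfer rk); rewrite ?J0J ?AJ ?JE.
  have nm : (n <= m)%N by rewrite -rk rank_leq_row.
  exists (@index_partition n), (sigma_min Abar - alpha).
  rewrite subr_gt0; split=> // A Aa.
  have Ac v : (sigma_min Abar - alpha) * enorm v <= enorm (A *m v).
    move/(spec_ballP _ _ alpha0): Aa => /(_ v) h.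
    have := sigma_min_le Abar v nm => h1.
    have := ler_enormB (A *m v) ((A - Abar) *m v).
    by rewrite mulmxBl opprB addrC subrK -mulmxBl; nra.
  split=> //; first by move=> t [].
    by move=> t _ v _; apply: Ac.
  left=> v Av; apply/eqP; rewrite -enorm_eq0 eq_le enorm_ge0 andbT.
  by have := Ac v; rewrite Av enorm0 pmulr_rle0 // subr_gt0.
have [M M0 UM] := compact_params_bounded U_compact.
pose M' := M + (specnorm Abar + alpha).
have sa0 : 0 <= specnorm Abar + alpha by rewrite addr_ge0 ?specnorm_ge0.
apply: (@regular_lipschitz _ _ _ _ T c M') => //.
- by rewrite addr_ge0.
- move=> p [Up Ap]; have [h1 h2] := UM _ Up; split.
  + exact: U_nonneg.
  + exact: Areg.
  split; [by rewrite (le_trans h1) // lerDl | by rewrite (le_trans h2) // lerDl |].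
  move=> v; move/(spec_ballP _ _ alpha0): Ap => /(_ v) h.
  have h3 := enorm_mulmx_le Abar v.
  have := enormD ((p.2 - Abar) *m v) (Abar *m v).
  rewrite -mulmxDl subrK => h4; rewrite /M'.
  have := mulr_ge0 M0 (enorm_ge0 v); nra.
move=> p p' s [Up Ap] [Up' Ap'] s01; apply: conj.
  exact: (convex_set_segment U_convex Up Up' s01).
exact: spec_ball_convex.
Qed.
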